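(* Let $X$ and $Y$ be Banach spaces and suppose that $Y$ has nontrivial type. Let $\alpha\in[0,1]$ and suppose there is a coarse map $X\to Y$ which is expanding at rate $\alpha$. Then $q_X\le\frac{q_Y}{1-\alpha}$ (where the right-hand side is understood as $\infty$ if $\alpha=1$).
   Context: A map $f\colon X\to Y$ between Banach spaces is coarse if $\omega_f(t)=\sup\{\|f(x)-f(z)\| : \|x-z\|\le t\}<\infty$ for all $t\ge 0$. For $\alpha\in[0,1]$, a map $f\colon X\to Y$ between Banach spaces is expanding at rate $\alpha$ if for every $L>0$ there is a map $\rho\colon[0,\infty)\to[0,\infty)$ with $\lim_{t\to\infty}\rho(t)=\infty$ such that, for all $x,z\in X$, $\|x-z\|\ge L\max\{\|x\|^\alpha,\|z\|^\alpha\}+L$ implies $\|f(x)-f(z)\|\ge\rho(\|x-z\|)$ (for $\alpha=0$ read $\|x\|^0=1$). A Banach space $X$ has type $p\in(1,2]$ if there is $C>0$ such that $\frac{1}{2^n}\sum_{(\varepsilon_i)\in\{-1,1\}^n}\left\|\sum_{i=1}^n\varepsilon_ix_i\right\|^p\le C\sum_{i=1}^n\|x_i\|^p$ for all $n\in\mathbb N$ and $x_1,\dots,x_n\in X$; it has trivial type if it has type $p$ for no $p\in(1,2]$, and nontrivial type otherwise. $X$ has cotype $q\in[2,\infty)$ if there is $C>0$ such that $\frac{1}{2^n}\sum_{(\varepsilon_i)\in\{-1,1\}^n}\left\|\sum_{i=1}^n\varepsilon_ix_i\right\|^q\ge C\sum_{i=1}^n\|x_i\|^q$ for all $n\in\mathbb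 N$ and $x_1,\dots,x_n\in X$. We let $q_X=\inf\{q\in[2,\infty) : X\text{ has cotype }q\}$, with $q_X=\infty$ if $X$ has no cotype in $[2,\infty)$. *)

(* Defs.v *)
From HB Require Import structures.
From mathcomp Require Import all_boot all_order all_algebra.
From mathcomp Require Import all_classical all_reals all_analysis.

Set Implicit Arguments.
Unset Strict Implicit.
Unset Printing Implicit Defensive.

Import Order.TTheory GRing.Theory Num.Theory.
Import numFieldNormedType.Exports.

Local Open Scope classical_set_scope.
Local Open Scope ring_scope.

Definition expansion_modulus (R : realType) (X Y : normedModType R)
    (f : X -> Y) (t : R) : \bar R :=
  ereal_sup [set d | exists x z : X, `|x - z| <= t /\ d = (`|f x - f z|)%:E].

Definition coarse (R : realType) (X Y : normedModType R) (f : X -> Y) : Prop :=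
  forall t : R, 0 <= t -> (expansion_modulus f t < +oo)%E.

(* Only the values of rho on [0, +oo[ matter.  The real power satisfies
   0 `^ 0 = 1, so for alpha = 0 both powers of norms are identically 1. *)
Definition expanding_at_rate (R : realType) (X Y : normedModType R)
    (alpha : R) (f : X -> Y) : Prop :=
  forall L : R, 0 < L ->
  exists rho : R -> R,
    [/\ forall t : R, 0 <= t -> 0 <= rho t,
        rho t @[t --> +oo] --> +oo
      & forall x z : X,
          L * Num.max (`|x| `^ alpha) (`|z| `^ alpha) + L <= `|x - z| ->
          rho `|x - z| <= `|f x - f z| ].

(* The sign vectors in {-1, 1}^n are indexed by boolean vectors e, with
   eps_i = (-1) ^+ e i. *)
Definition sign_average (R : realType) (X : normedModType R) (r : R) (n : nat)
    (x : 'I_n -> X) : R :=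
  (2 ^+ n)^-1 *
  \sum_(e : {ffun 'I_n -> bool}) `| \sum_(i < n) (-1) ^+ e i *: x i | `^ r.

Definition has_type (R : realType) (X : normedModType R) (p : R) : Prop :=
  exists2 C : R, 0 < C &
    forall (n : nat) (x : 'I_n -> X),
      sign_average p x <= C * \sum_(i < n) `|x i| `^ p.

Definition nontrivial_type (R : realType) (X : normedModType R) : Prop :=
  exists p : R, [/\ 1 < p, p <= 2 & has_type X p].

Definition has_cotype (R : realType) (X : normedModType R) (q : R) : Prop :=
  exists2 C : R, 0 < C &
    forall (n : nat) (x : 'I_n -> X),
      C * \sum_(i < n) `|x i| `^ q <= sign_average q x.

(* The infimum of the empty set is +oo. *)
Definition cotype_index (R : realType) (X : normedModType R) : \bar R :=
  ereal_inf [set q%:E | q in [set q : R | 2 <= q /\ has_cotype X q]].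

(* Main.v *)
(* Let Y have nontrivial type and cotype q.

   K-convexity.  The noise operators P_t on Y-valued functions on the cube,
   with Walsh symbol exp (- t |s|), are averages of the projections a_B onto
   functions not depending on the coordinates in B.  Nontrivial type bounds the
   norm of every product (1 - a_{B_1}) ... (1 - a_{B_N}) strictly below 2^N, so
   1 + P_t has an inverse bounded uniformly in t and in the dimension.  Hence the
   resolvents of the generator on the imaginary axis are bounded, hence so is
   t |s| exp (- t |s|), and the projection onto the level |s| = 1 comes out of
   Taylor series and a discrete Fourier inversion.  All of this is done with
   real scalars: only the even combinations of resolvents occur.

   Metric cotype.  For g on a finite abelian group with generators a_j, averaging
   g over the signed steps with j-th sign + turns the increment along 2 a_j into
   twice a Rademacher coefficient; K-convexity and cotype q make this small for
   some j in a given set of directions.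

   The theorem.  Suppose the vectors v_i have bounded average and |v_i| >= d on a
   set J.  A zigzag embedding of the torus (Z/4l)^n into X, with l of order
   |J|^(1/q), followed by the coarse map f, has two points at distance >= l d and
   of norm < 4 l whose images stay at bounded distance.  Expansion at rate alpha
   then forces d |J|^((1 - alpha) / q) <= B.  This is a weak cotype
   q / (1 - alpha) inequality, and summing over dyadic levels gives cotype r for
   every r > q / (1 - alpha). *)

Require Import Defs.
From HB Require Import structures.
From mathcomp Require Import all_boot all_order all_algebra.
From mathcomp Require Import all_classical all_reals all_analysis.
From mathcomp Require Import zify ring lra.

Set Implicit Arguments.
Unset Strict Implicit.
Unset Printing Implicit Defensive.

Import Order.TTheory GRing.Theory Num.Theory.
Import numFieldNormedType.Exports.

Local Open Scope classical_set_scope.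
Local Open Scope ring_scope.

(** * Minkowski inequality *)

(** Two constraints shape the argument. Every constant must be independent of the dimension n of the
    cube, yet all limits are taken inside one fixed cube: there a uniformly small symbol is a small
    multiplier up to a factor 2^n, so pointwise convergence of symbols under a uniform bound
    replaces any functional calculus. And scalars are real, so complex analysis is replaced by
    finite trigonometric identities. The factor 1 - 2 cos (pi / J) w + w^2 of 1 + w^J, at w = exp (-
    h x), has as inverse a polynomial in w times (1 + w^J)^-1; with h J = pi / lam fixed and J
    growing, this inverse, rescaled by h^2, tends to 1 / (x^2 + lam^2). The Cauchy integral for the
    derivative of the semigroup becomes an alternating sum of Poisson kernels at the angles pi j /
    H, which isolates the coefficient w^H; summation by parts produces second differences of order
    j^-2, hence bounds uniform in H. On the metric side, an increment along 2 l a_j costs a factor 4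
    + 2 l (K / |J|)^(1/q), so l of order |J|^(1/q) is the largest scale at which it stays
    bounded. *)

Lemma powRV (R : realType) (a q : R) : 0 <= a -> a^-1 `^ q = (a `^ q)^-1.
Proof. by move=> a0; rewrite -powR_inv1// -powRrM mulN1r powRN. Qed.

Lemma powR_convex2 (R : realType) (q t x y : R) : 1 <= q -> 0 <= t <= 1 ->
  0 <= x -> 0 <= y ->
  (t * x + (1 - t) * y) `^ q <= t * x `^ q + (1 - t) * y `^ q.
Proof.
move=> q1 /andP[t0 t1] x0 y0.
have := @convex_powR R q q1 (Itv01 t0 t1) x y.
rewrite !convRE /= /unstable.onem.
by apply; rewrite inE /= in_itv /= ?x0 ?y0.
Qed.

Lemma powR_sum_le (R : realType) (q : R) (n : nat) (a : 'I_n -> R) :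
  1 <= q -> (forall i, 0 <= a i) -> (0 < n)%N ->
  ((\sum_i a i) / n%:R) `^ q <= (\sum_i a i `^ q) / n%:R.
Proof.
move=> q1; case: n a => // n a a0 _; elim: n a a0 => [|n IH] a a0.
  by rewrite !big_ord1 !divr1.
rewrite !(big_ord_recr n.+1) /=.
set S := \sum_(i < n.+1) a _; set Sq := \sum_(i < n.+1) _ `^ q.
have IH' := IH (fun i => a (widen_ord (leqnSn n.+1) i)) (fun i => a0 _).
have N0 : (n.+1%:R : R) != 0 by rewrite pnatr_eq0.
have N1 : (n.+2%:R : R) != 0 by rewrite pnatr_eq0.
have Nt : 0 <= (n.+1%:R / n.+2%:R : R) <= 1.
  by rewrite divr_ge0 ?ler0n//= ler_pdivrMr ?ltr0n// mul1r ler_nat.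
have e x y : (x + y) / n.+2%:R =
    n.+1%:R / n.+2%:R * (x / n.+1%:R) + (1 - n.+1%:R / n.+2%:R) * y :> R.
  have E : (n.+2%:R : R) = n.+1%:R + 1 by rewrite [RHS]natr1.
  by move: N0 N1; rewrite E; set u : R := n.+1%:R => u0 u1; field; apply/andP; split.
rewrite !e; apply: le_trans (powR_convex2 q1 Nt _ (a0 _)) _.
  by rewrite divr_ge0// sumr_ge0// => i _; exact: a0.
by rewrite lerD2r ler_wpM2l//; case/andP: Nt.
Qed.

(** Norm for the counting measure; the missing normalisation cancels in every operator bound. *)
Definition lq (R : realType) (Y : normedModType R) (T : finType) (q : R)
  (F : T -> Y) : R := (\sum_(w : T) `|F w| `^ q) `^ q^-1.

Section Lq.
Context (R : realType) (Y : normedModType R) (T : finType) (q : R).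
Hypothesis q1 : 1 <= q.
Implicit Types F G : T -> Y.

Let q0 : 0 < q := lt_le_trans ltr01 q1.

Lemma lq_ge0 F : 0 <= lq q F.
Proof. exact: powR_ge0. Qed.

Lemma lqX F : lq q F `^ q = \sum_w `|F w| `^ q.
Proof.
rewrite /lq -powRrM mulVf ?gt_eqF// powRr1// sumr_ge0//.
Qed.

Lemma lq_le F (c : R) : 0 <= c ->
  \sum_w `|F w| `^ q <= c `^ q -> lq q F <= c.
Proof.
move=> c0; rewrite -lqX => h; rewrite leNgt; apply/negP => ltc.
by have := gt0_ltr_powR q0 c0 (lq_ge0 F) ltc; rewrite ltNge h.
Qed.

Lemma le_lqX F (c : R) : lq q F <= c -> \sum_w `|F w| `^ q <= c `^ q.
Proof.
move=> h; rewrite -lqX ge0_ler_powR ?nnegrE ?lq_ge0// ?(ltW q0)//.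
exact: le_trans (lq_ge0 F) h.
Qed.

Lemma lqZ (a : R) F : lq q (fun w => a *: F w) = `|a| * lq q F.
Proof.
rewrite /lq; under eq_bigr do rewrite normrZ powRM//.
rewrite -mulr_sumr powRM ?powR_ge0//; last first.
  by rewrite sumr_ge0// => w _; rewrite powR_ge0.
by rewrite -powRrM divff ?gt_eqF// powRr1.
Qed.

(** With weight a / (a + b), F + G is (a + b) times a convex combination of F / a and G / b, so
    convexity of the q-th power applies pointwise. The norms are replaced by upper bounds a, b > 0
    because a norm may vanish; [lqD] removes the slack. *)
Lemma minkowski_sum F G (a b : R) : 0 < a -> 0 < b ->
  \sum_w `|F w| `^ q <= a `^ q -> \sum_w `|G w| `^ q <= b `^ q ->
  \sum_w `|F w + G w| `^ q <= (a + b) `^ q.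
Proof.
move=> a0 b0 Fa Gb.
have ab0 : 0 < a + b by rewrite addr_gt0.
have t01 : 0 <= a / (a + b) <= 1.
  by rewrite divr_ge0 ?(ltW a0) ?(ltW ab0)//= ler_pdivrMr// mul1r lerDl (ltW b0).
have step w : `|F w + G w| `^ q <= (a + b) `^ q *
    (a / (a + b) * (`|F w| `^ q / a `^ q) +
     (1 - a / (a + b)) * (`|G w| `^ q / b `^ q)).
  have -> : `|F w| `^ q / a `^ q = (`|F w| / a) `^ q.
    by rewrite powRM ?invr_ge0 ?(ltW a0)// powRV// ltW.
  have -> : `|G w| `^ q / b `^ q = (`|G w| / b) `^ q.
    by rewrite powRM ?invr_ge0 ?(ltW b0)// powRV// ltW.
  apply: (le_trans (y := ((a + b) * (a / (a + b) * (`|F w| / a) +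
     (1 - a / (a + b)) * (`|G w| / b))) `^ q)).
    rewrite ge0_ler_powR ?nnegrE ?(ltW q0)//.
    - rewrite mulr_ge0 ?(ltW ab0)// addr_ge0// mulr_ge0
        ?divr_ge0 ?(ltW a0) ?(ltW b0) ?(ltW ab0)//.
      by rewrite subr_ge0; case/andP: t01.
    - apply: le_trans (ler_normD _ _) _; rewrite le_eqVlt; apply/orP; left.
      by apply/eqP; field; rewrite !gt_eqF.
  rewrite powRM ?(ltW ab0)//; last first.
    rewrite addr_ge0// mulr_ge0 ?divr_ge0 ?(ltW a0) ?(ltW b0) ?(ltW ab0)//.
    by rewrite subr_ge0; case/andP: t01.
  rewrite ler_wpM2l ?powR_ge0//.
  by apply: powR_convex2 => //; rewrite divr_ge0 ?(ltW a0) ?(ltW b0).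
apply: le_trans (ler_sum _ (fun w _ => step w)) _.
rewrite -mulr_sumr -[leRHS]mulr1 ler_wpM2l ?powR_ge0// big_split/= -!mulr_sumr -!mulr_suml.
apply: (le_trans (y := a / (a + b) * 1 + (1 - a / (a + b)) * 1)); last first.
  by rewrite !mulr1 addrC subrK.
by case/andP: t01 => t0 t1; apply: lerD;
  rewrite ler_wpM2l ?subr_ge0// ler_pdivrMr ?mul1r ?powR_gt0.
Qed.

Lemma lqD F G : lq q (fun w => F w + G w) <= lq q F + lq q G.
Proof.
apply/ler_addgt0Pr => e e_gt0.
have e20 : 0 < e / 2 by rewrite divr_gt0.
have -> : lq q F + lq q G + e = (lq q F + e / 2) + (lq q G + e / 2).
  by rewrite addrACA -splitr.
have a0 : 0 < lq q F + e / 2 by rewrite ltr_wpDl ?lq_ge0.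
have b0 : 0 < lq q G + e / 2 by rewrite ltr_wpDl ?lq_ge0.
apply: lq_le (ltW (addr_gt0 a0 b0)) _.
by apply: minkowski_sum => //; apply: le_lqX; rewrite lerDl divr_ge0// ltW.
Qed.

Lemma lq_sum (I : finType) (P : pred I) (F : I -> T -> Y) :
  lq q (fun w => \sum_(i | P i) F i w) <= \sum_(i | P i) lq q (F i).
Proof.
suff h (s : seq I) : lq q (fun w => \sum_(i <- s | P i) F i w) <=
    \sum_(i <- s | P i) lq q (F i) by exact: h.
elim: s => [|i s IH].
  rewrite big_nil; apply: lq_le => //; rewrite powR0 ?gt_eqF//.
  by rewrite big1// => w _; rewrite big_nil normr0 powR0 ?gt_eqF.
rewrite big_cons; under [X in lq q X]eq_fun do rewrite big_cons.
case: (P i) => //; apply: le_trans (lqD _ _) _.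
by rewrite lerD2l.
Qed.

Lemma lqN F : lq q (fun w => - F w) = lq q F.
Proof. by rewrite /lq; under eq_bigr do rewrite normrN. Qed.

Lemma lq_reindex (h : T -> T) F : injective h ->
  lq q (fun w => F (h w)) = lq q F.
Proof. by move=> hi; rewrite /lq [in RHS](reindex_inj hi). Qed.

End Lq.

Opaque lq.

(** * Walsh multipliers *)

Notation signs n := {ffun 'I_n -> bool}.

Definition flip n (v w : signs n) : signs n := [ffun i => v i (+) w i].

Lemma flipK n (v : signs n) : involutive (flip v).
Proof. by move=> w; apply/ffunP => i; rewrite !ffunE addKb. Qed.

Lemma flip_inj n (v : signs n) : injective (flip v).
Proof. exact: inv_inj (flipK v). Qed.

Section Walsh.
Context (R : realType) (n : nat).
Implicit Types s v w : signs n.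

(** A character of the sign group. Index and point are both boolean vectors, so one orthogonality
    relation serves for characters and for points. *)
Definition walsh s w : R := \prod_i (-1) ^+ (s i && w i).

Lemma walshC s w : walsh s w = walsh w s.
Proof. by apply: eq_bigr => i _; rewrite andbC. Qed.

Lemma normr_walsh s w : `|walsh s w| = 1.
Proof. by rewrite normr_prod big1// => i _; rewrite normrX normrN1 expr1n. Qed.

Lemma walsh_flip s v w : walsh s (flip v w) = walsh s v * walsh s w.
Proof.
rewrite /walsh -big_split; apply: eq_bigr => i _; rewrite ffunE.
by case: (s i); case: (v i); case: (w i);
  rewrite /= ?expr0 ?expr1 ?mulr1 ?mul1r ?mulrNN ?mulr1.
Qed.

Lemma walsh_orthogonal v w :
  \sum_s walsh s v * walsh s w = 2 ^+ n * (v == w)%:R.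
Proof.
under eq_bigr do rewrite -walsh_flip /walsh.
have /= <- := bigA_distr_bigA (fun i (b : bool) => (-1) ^+ (b && flip v w i) : R).
have [->|vw] := eqVneq v w.
  rewrite mulr1; under eq_bigr => i _ do rewrite big_bool/= ffunE addbb expr0.
  by rewrite prodr_const card_ord.
have [i vwi] : exists i, v i != w i.
  apply/existsP; apply: contraNT vw; rewrite negb_exists => /forallP h.
  by apply/eqP/ffunP => i; apply/eqP; move: (h i); rewrite negbK.
rewrite mulr0 (bigD1 i)//= big_bool/= ffunE.
by rewrite -negb_eqb vwi expr0 expr1 addrC subrr mul0r.
Qed.

End Walsh.

Section Multipliers.
Context (R : realType) (Y : normedModType R) (n : nat) (q : R).
Hypothesis q1 : 1 <= q.
Implicit Types (F : signs n -> Y) (m : signs n -> R).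

Definition walsh_coef F s : Y := \sum_w walsh R s w *: F w.

Definition multiplier m F w : Y :=
  (2 ^+ n)^-1 *: \sum_s (m s * walsh R s w) *: walsh_coef F s.

Let two_neq0 : 2 ^+ n != 0 :> R.
Proof. by rewrite expf_neq0. Qed.

Lemma walsh_coef_multiplier m F s :
  walsh_coef (multiplier m F) s = m s *: walsh_coef F s.
Proof.
rewrite {1}/walsh_coef /multiplier.
under eq_bigr => w _ do rewrite scalerA mulrC -scalerA scaler_sumr.
rewrite -scaler_sumr exchange_big/= (bigD1 s)//= [X in _ + X]big1 ?addr0.
  under eq_bigr do rewrite scalerA mulrCA.
  rewrite -scaler_suml -mulr_sumr.
  under eq_bigr do rewrite walshC; rewrite walsh_orthogonal eqxx mulr1.
  by rewrite scalerA mulrCA mulVf ?mulr1.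
move=> u us; under eq_bigr do rewrite scalerA mulrCA.
rewrite -scaler_suml -mulr_sumr.
under eq_bigr do rewrite walshC [X in _ * X]walshC; rewrite walsh_orthogonal.
by rewrite eq_sym (negbTE us) !mulr0 scale0r.
Qed.

Lemma multiplierM m1 m2 F :
  multiplier m1 (multiplier m2 F) = multiplier (fun s => m1 s * m2 s) F.
Proof.
apply/funext => w; rewrite {1}/multiplier; congr (_ *: _).
by apply: eq_bigr => s _; rewrite walsh_coef_multiplier scalerA mulrAC.
Qed.

(** Multiplying each character by its value at v is translation by v. Translations preserve the
    norm; the contractions used later are averages and products of them. *)
Lemma multiplier_walsh v F :
  multiplier (fun s => walsh R s v) F = fun w => F (flip v w).
Proof.
apply/funext => w; rewrite /multiplier.
under eq_bigr do rewrite -walsh_flip /walsh_coef scaler_sumr.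
rewrite exchange_big/= (bigD1 (flip v w))//= [X in _ + X]big1 ?addr0.
  under eq_bigr do rewrite scalerA.
  by rewrite -scaler_suml walsh_orthogonal eqxx mulr1 scalerA mulVf// scale1r.
move=> u us; under eq_bigr do rewrite scalerA.
by rewrite -scaler_suml walsh_orthogonal eq_sym (negbTE us) mulr0 scale0r.
Qed.

(* The pointwise bound would follow from the operator bound, except when Y is
   the zero space. *)
Record bounded_multiplier (c : R) m : Prop := BoundedMultiplier {
  bm_abs : forall s, `|m s| <= c;
  bm_lq : forall F, lq q (multiplier m F) <= c * lq q F }.

Local Notation bm := bounded_multiplier.

Lemma bm_ge0 c m : bm c m -> 0 <= c.
Proof. by case=> h _; exact: le_trans (h [ffun=> false]). Qed.

Lemma bm_ext c m1 m2 : (forall s, m1 s = m2 s) -> bm c m1 -> bm c m2.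
Proof. by move=> /funext ->. Qed.

Lemma bm_le c d m : c <= d -> bm c m -> bm d m.
Proof.
move=> cd [h1 h2]; split=> [s|F]; first exact: le_trans (h1 s) cd.
by apply: le_trans (h2 F) _; rewrite ler_wpM2r// lq_ge0.
Qed.

Lemma bm_walsh v : bm 1 (fun s => walsh R s v).
Proof.
split=> [s|F]; first by rewrite normr_walsh.
by rewrite multiplier_walsh mul1r lq_reindex//; exact: flip_inj.
Qed.

Lemma bm1 : bm 1 (fun=> 1).
Proof.
apply: bm_ext (bm_walsh [ffun=> false]) => s.
by rewrite /walsh big1// => i _; rewrite ffunE andbF.
Qed.

Lemma bmD c d m1 m2 : bm c m1 -> bm d m2 -> bm (c + d) (fun s => m1 s + m2 s).
Proof.
move=> [h1 h2] [k1 k2]; split=> [s|F].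
  by apply: le_trans (ler_normD _ _) _; rewrite lerD.
rewrite mulrDl; apply: le_trans (lerD (h2 F) (k2 F)).
apply: le_trans (lqD q1 _ _).
suff -> : multiplier (fun s => m1 s + m2 s) F =
  (fun w => multiplier m1 F w + multiplier m2 F w) by exact: lexx.
apply/funext => w; rewrite /multiplier -scalerDr -big_split/=.
by congr (_ *: _); apply: eq_bigr => s _; rewrite mulrDl scalerDl.
Qed.

Lemma bmM c d m1 m2 : bm c m1 -> bm d m2 -> bm (c * d) (fun s => m1 s * m2 s).
Proof.
move=> [h1 h2] [k1 k2]; have c0 := bm_ge0 (BoundedMultiplier h1 h2); split=> [s|F].
  by rewrite normrM ler_pM.
rewrite -multiplierM; apply: le_trans (h2 _) _.
by rewrite -mulrA ler_wpM2l.
Qed.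

Lemma bmZ a c m : bm c m -> bm (`|a| * c) (fun s => a * m s).
Proof.
move=> [h1 h2]; split=> [s|F]; first by rewrite normrM ler_wpM2l.
rewrite -mulrA; apply: le_trans (ler_wpM2l (normr_ge0 a) (h2 F)).
rewrite -(lqZ q1); suff -> : multiplier (fun s => a * m s) F =
  (fun w => a *: multiplier m F w) by exact: lexx.
apply/funext => w; rewrite /multiplier [RHS]scalerA [a * _]mulrC -[RHS]scalerA.
rewrite [a *: _]scaler_sumr; congr (_ *: _); apply: eq_bigr => s _.
by rewrite scalerA mulrA.
Qed.

Lemma bm_sum (I : finType) (P : pred I) (c : I -> R) (m : I -> signs n -> R) :
  (forall i, P i -> bm (c i) (m i)) ->
  bm (\sum_(i | P i) c i) (fun s => \sum_(i | P i) m i s).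
Proof.
move=> h; suff k (t : seq I) : bm (\sum_(i <- t | P i) c i)
    (fun s => \sum_(i <- t | P i) m i s) by exact: k.
elim: t => [|i t IH].
  rewrite big_nil; have := bmZ 0 bm1; rewrite normr0 mul0r.
  by apply: bm_ext => s; rewrite big_nil.
rewrite big_cons; case: (boolP (P i)) => Pi.
  by apply: bm_ext (bmD (h _ Pi) IH) => s; rewrite big_cons Pi.
by apply: bm_ext IH => s; rewrite big_cons (negbTE Pi).
Qed.

Lemma bm_prod (I : finType) (P : pred I) (m : I -> signs n -> R) :
  (forall i, P i -> bm 1 (m i)) ->
  bm 1 (fun s => \prod_(i | P i) m i s).
Proof.
move=> h; suff k (t : seq I) : bm 1
    (fun s => \prod_(i <- t | P i) m i s) by exact: k.
elim: t => [|i t IH].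
  by apply: bm_ext bm1 => s; rewrite big_nil.
case: (boolP (P i)) => Pi.
  rewrite -[X in bm X _]mulr1.
  by apply: bm_ext (bmM (h _ Pi) IH) => s; rewrite big_cons Pi.
by apply: bm_ext IH => s; rewrite big_cons (negbTE Pi).
Qed.

Lemma bmX c m k : bm c m -> bm (c ^+ k) (fun s => m s ^+ k).
Proof.
move=> h; elim: k => [|k IH]; first exact: bm1.
by rewrite exprS; apply: bm_ext (bmM h IH) => s; rewrite exprS.
Qed.

(** By orthogonality the indicator of t is an average of the symbols [walsh R s v] over v with
    coefficients of modulus 1. *)
Lemma bm_point t : bm 1 (fun s => (s == t)%:R).
Proof.
have h := bmZ ((2 ^+ n)^-1)
  (@bm_sum _ xpredT _ _ (fun v _ => bmZ (walsh R t v) (bm_walsh v))).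
apply: bm_le (bm_ext _ h) => [|s].
  under eq_bigr do rewrite normr_walsh mulr1.
  rewrite sumr_const card_ffun card_bool card_ord natrX ger0_norm ?invr_ge0 ?exprn_ge0//.
  by rewrite mulVf.
under eq_bigr do rewrite walshC [X in _ * X]walshC.
by rewrite walsh_orthogonal mulrA mulVf// mul1r eq_sym.
Qed.

(** A crude bound, summing over the points of the cube; it serves only for errors that tend to 0
    while n stays fixed. *)
Lemma bm_small e m : (forall s, `|m s| <= e) -> bm (2 ^+ n * e) m.
Proof.
move=> h; have k := @bm_sum _ xpredT _ _ (fun t _ => bmZ (m t) (bm_point t)).
apply: bm_le (bm_ext _ k) => [|s].
  apply: (le_trans (y := \sum_(t : signs n) e)).
    by apply: ler_sum => t _; rewrite mulr1.
  by rewrite sumr_const card_ffun card_bool card_ord -[leLHS]mulr_natl natrX.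
rewrite (bigD1 s)//= eqxx mulr1 big1 ?addr0// => t /negbTE ts.
by rewrite eq_sym ts mulr0.
Qed.

End Multipliers.

(** * Nontrivial type and noise operators *)

Lemma sum_le_exists (R : realType) (T : finType) (P : pred T) (t0 : T)
    (f g : T -> R) : P t0 ->
  \sum_(t | P t) f t <= \sum_(t | P t) g t -> exists2 t, P t & f t <= g t.
Proof.
move=> Pt0 h; apply/not_exists2P => k.
have {}k t : P t -> 0 < f t - g t.
  by move=> Pt; rewrite subr_gt0 ltNge; apply/negP; case: (k t).
have : \sum_(t | P t) (f t - g t) <= 0 by rewrite sumrB subr_le0.
rewrite leNgt => /negP; apply; rewrite (bigD1 t0)//= ltr_pwDl ?k//.
by apply: sumr_ge0 => t /andP[Pt _]; rewrite ltW ?k.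
Qed.

Lemma multiplier_sum (R : realType) (Y : normedModType R) (n : nat)
    (I : finType) (c : I -> R) (m : I -> signs n -> R) (F : signs n -> Y) w :
  multiplier (fun s => \sum_i c i * m i s) F w =
  \sum_i c i *: multiplier (m i) F w.
Proof.
rewrite /multiplier; under [RHS]eq_bigr do rewrite scalerA mulrC -scalerA scaler_sumr.
rewrite -scaler_sumr exchange_big/=; congr (_ *: _); apply: eq_bigr => s _.
rewrite mulr_suml scaler_suml; apply: eq_bigr => i _.
by rewrite scalerA mulrA.
Qed.

Section TypeToMultiplier.
Context (R : realType) (Y : normedModType R) (p q C : R).
Hypotheses (p1 : 1 < p) (pq : p <= q) (C0 : 0 < C).
Hypothesis hC : forall (n : nat) (x : 'I_n -> Y),
  sign_average p x <= C * \sum_(i < n) `|x i| `^ p.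

Let q1 : 1 <= q := le_trans (ltW p1) pq.
Let q0 : 0 < q := lt_le_trans ltr01 q1.
Let p0 : 0 < p := lt_trans ltr01 p1.

Let qE (b : R) : b `^ q = b `^ (q - p) * b `^ p.
Proof. by rewrite -powRD subrK// gt_eqF. Qed.

Lemma powR_mul_le_add (u a : R) : 0 <= u -> 0 <= a ->
  u `^ (q - p) * a `^ p <= u `^ q + a `^ q.
Proof.
move=> u0 a0.
have [ua|au] := leP u a.
  apply: (le_trans (y := a `^ q)); last by rewrite lerDr powR_ge0.
  rewrite qE ler_wpM2r ?powR_ge0//.
  by rewrite ge0_ler_powR ?nnegrE ?subr_ge0.
apply: (le_trans (y := u `^ q)); last by rewrite lerDl powR_ge0.
rewrite qE ler_wpM2l ?powR_ge0//.
by rewrite ge0_ler_powR ?nnegrE// ltW.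
Qed.

(** Type governs only the exponent p. The remaining power q - p of the signed sum is bounded by the
    triangle inequality, hence by N times the mean of the norms; [powR_mul_le_add] and Jensen
    recombine the exponents. The factor N^(q - p) beats the trivial N^(q - 1) for large N because p
    > 1. *)
Lemma type_sum_powR (N : nat) (x : 'I_N -> Y) : (0 < N)%N ->
  \sum_(e : signs N) `|\sum_i (-1) ^+ e i *: x i| `^ q <=
  2 ^+ N * (2 * C * N%:R `^ (q - p)) * \sum_i `|x i| `^ q.
Proof.
move=> N0; set S := \sum_i `|x i|; set Nr : R := N%:R.
have Nr0 : 0 < Nr by rewrite ltr0n.
have S0 : 0 <= S by rewrite sumr_ge0.
have SN0 : 0 <= S / Nr by rewrite divr_ge0 ?(ltW Nr0).
have hS (e : signs N) : `|\sum_i (-1) ^+ e i *: x i| <= S.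
  apply: le_trans (ler_norm_sum _ _ _) _; apply: ler_sum => i _.
  by rewrite normrZ normrX normrN1 expr1n mul1r.
have T : \sum_(e : signs N) `|\sum_i (-1) ^+ e i *: x i| `^ p <=
    2 ^+ N * (C * \sum_i `|x i| `^ p).
  by rewrite mulrC -ler_pdivrMr ?exprn_gt0// mulrC; exact: hC.
apply: (le_trans (y := S `^ (q - p) * (2 ^+ N * (C * \sum_i `|x i| `^ p)))).
  apply: le_trans (ler_wpM2l (powR_ge0 _ _) T); rewrite mulr_sumr.
  apply: ler_sum => e _; rewrite [leLHS]qE.
  by rewrite ler_wpM2r ?powR_ge0// ge0_ler_powR ?nnegrE ?subr_ge0.
have -> : S `^ (q - p) = Nr `^ (q - p) * (S / Nr) `^ (q - p).
  by rewrite -powRM ?(ltW Nr0)// mulrC divfK ?gt_eqF.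
have -> : Nr `^ (q - p) * (S / Nr) `^ (q - p) *
    (2 ^+ N * (C * \sum_i `|x i| `^ p)) =
    2 ^+ N * (C * Nr `^ (q - p)) *
    \sum_i ((S / Nr) `^ (q - p) * `|x i| `^ p).
  by rewrite -mulr_sumr; ring.
have -> : 2 ^+ N * (2 * C * Nr `^ (q - p)) * (\sum_i `|x i| `^ q) =
    2 ^+ N * (C * Nr `^ (q - p)) * (2 * \sum_i `|x i| `^ q) by ring.
rewrite ler_wpM2l ?mulr_ge0 ?exprn_ge0 ?powR_ge0 ?(ltW C0)//.
apply: le_trans (ler_sum _ (fun i _ => powR_mul_le_add SN0 (normr_ge0 (x i)))) _.
rewrite big_split/= mulrDl mul1r lerD2r sumr_const card_ord -mulr_natl.
have := powR_sum_le q1 (fun i => normr_ge0 (x i)) N0.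
by rewrite ler_pdivlMr// mulrC.
Qed.

(** The average over e is taken after summing over w, so a single e serves all w. The hypothesis on
    N turns the estimate into a gain of 1/2 over the triangle inequality. *)
Lemma type_signs_lq (N n : nat) (F : 'I_N -> signs n -> Y) (L : R) :
  (0 < N)%N -> 0 <= L -> 2 * C * N%:R `^ (q - p) * N%:R <= (N%:R / 2) `^ q ->
  (forall i, lq q (F i) <= L) ->
  exists e : signs N, lq q (fun w => \sum_i (-1) ^+ e i *: F i w) <= N%:R / 2 * L.
Proof.
move=> N0 L0 hN hF.
have [e _ he] : exists2 e : signs N, xpredT e &
    \sum_w `|\sum_i (-1) ^+ e i *: F i w| `^ q <= (N%:R / 2 * L) `^ q.
  apply: (@sum_le_exists _ _ _ [ffun=> false]) => //.
  rewrite exchange_big/=.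
  apply: le_trans (ler_sum _ (fun w _ => type_sum_powR (fun i => F i w) N0)) _.
  rewrite -mulr_sumr exchange_big/= sumr_const card_ffun card_bool card_ord.
  rewrite -[leRHS]mulr_natl natrX -[leLHS]mulrA ler_wpM2l ?exprn_ge0//.
  apply: (le_trans (y := 2 * C * N%:R `^ (q - p) * (N%:R * L `^ q))).
    rewrite ler_wpM2l ?mulr_ge0 ?powR_ge0 ?(ltW C0)//.
    rewrite mulr_natl -[X in _ <= _ *+ X]card_ord -sumr_const.
    by apply: ler_sum => i _; exact: le_lqX (hF i).
  rewrite mulrA powRM ?divr_ge0// ler_wpM2r ?powR_ge0//.
exists e; apply: lq_le he => //; rewrite mulr_ge0// divr_ge0.
Qed.

(** Take N copies of the expansion of the product over subsets A, and from the i-th copy extract the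
    term where A is B with i added. If i is in B, idempotence allows a factor [a i] to be inserted;
    otherwise the parity of the set changes. Either way the term is - (-1)^|B| (-1)^(e i) [a i]
    times the product over B, so the extracted terms add up to the signed sum that type makes
    small. *)
Lemma prod_sub1_expand (N n : nat) (a : 'I_N -> signs n -> R) (e : signs N) s :
  (forall i s, a i s * a i s = a i s) ->
  let B := finset (fun i => e i) in
  N%:R * \prod_i (1 - a i s) =
  - (-1) ^+ #|B| * ((\prod_(i in B) a i s) * \sum_i (-1) ^+ e i * a i s) +
  \sum_i \sum_(A : {set 'I_N} | (A != i |: B)%SET) (-1) ^+ #|A| * \prod_(j in A) a j s.
Proof.
move=> idem B.
have E : \prod_i (1 - a i s) = \sum_(A : {set 'I_N}) (-1) ^+ #|A| * \prod_(j in A) a j s.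
  under eq_bigr do rewrite addrC.
  rewrite bigA_distr; apply: eq_bigr => A _.
  rewrite (bigID (mem A))/= [X in _ * X]big1 ?mulr1; last first.
    by move=> i /negbTE ->.
  under eq_bigr => i -> do rewrite -mulN1r.
  by rewrite big_split/= prodr_const.
rewrite [X in _ = X + _]mulrA [X in _ = X + _]mulr_sumr.
rewrite mulr_natl -[X in _ *+ X = _]card_ord -sumr_const -big_split/=.
apply: eq_bigr => i _; rewrite E (bigD1 (i |: B)%SET)//=; congr (_ + _).
have [iB|iB] := boolP (i \in B).
  rewrite (finset.setUidPr _) ?finset.sub1set//.
  have -> : e i = true by move: iB; rewrite inE.
  rewrite expr1 (bigD1 i)//=; set P := \prod_(_ in _ | _) _.
  set x : R := (-1) ^+ _.
  transitivity (x * P * (a i s * a i s)); first by rewrite idem; ring.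
  by ring.
rewrite cardsU1 iB big_setU1//= exprS.
have -> : e i = false by apply: negbTE; move: iB; rewrite inE.
by rewrite expr0 mul1r; ring.
Qed.

(** N copies of the expansion contain N 2^N contractions. The N extracted ones have total norm at
    most N / 2 for suitable signs, instead of N, which leaves N (2^N - 1/2). The signs depend on F,
    the bound does not. *)
Lemma bm_prod_sub1 (N n : nat) (a : 'I_N -> signs n -> R) :
  (0 < N)%N -> 2 * C * N%:R `^ (q - p) * N%:R <= (N%:R / 2) `^ q ->
  (forall i s, a i s * a i s = a i s) ->
  (forall i, bounded_multiplier Y q 1 (a i)) ->
  bounded_multiplier Y q (2 ^+ N - 2^-1) (fun s => \prod_i (1 - a i s)).
Proof.
move=> N0 hN idem ha; have Nr0 : 0 < N%:R :> R by rewrite ltr0n.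
split=> [s|F].
  (* Idempotent symbols take only the values 0 and 1. *)
  apply: (le_trans (y := 1)).
    rewrite normr_prod; apply: numdomain.Num.Theory.prodr_ile1 => i _; rewrite normr_ge0/=.
    have /eqP := idem i s; rewrite -subr_eq0 -{3}[a i s]mulr1 -mulrBr mulf_eq0.
    by case/orP=> /eqP h; [rewrite h subr0 normr1|rewrite -normrN opprB h normr0].
  rewrite lerBrDr; apply: (le_trans (y := 2 ^+ 1)); first by lra.
  by rewrite ler_weXn2l// ler1n.
have hF i : lq q (multiplier (a i) F) <= lq q F.
  by rewrite -[leRHS]mul1r; exact: bm_lq (ha i) F.
have [e he] := @type_signs_lq N n (fun i => multiplier (a i) F) (lq q F) N0
  (lq_ge0 _ _) hN hF.
pose B := finset (fun i => e i).
have b1 (A : {set 'I_N}) : bounded_multiplier Y q 1 (fun s => \prod_(j in A) a j s).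
  by apply: bm_prod => // i _.
have hb := bm_sum q1 (fun i (_ : xpredT i) =>
  bm_sum q1 (fun (A : {set 'I_N}) (_ : (A != i |: B)%SET) =>
    bmZ q1 ((-1) ^+ #|A|) (b1 A))).
set M2 := (fun s => \sum_i \sum_(A | (A != i |: B)%SET) _) in hb.
pose M1 s := (\prod_(i in B) a i s) * \sum_i (-1) ^+ e i * a i s.
have E : multiplier (fun s => N%:R * \prod_i (1 - a i s)) F =
    (fun w => (- (-1) ^+ #|B|) *: multiplier M1 F w + multiplier M2 F w).
  apply/funext => w.
  have := multiplier_sum (fun b : bool => if b then - (-1) ^+ #|B| else 1)
    (fun b => if b then M1 else M2) F w.
  rewrite big_bool/= scale1r => <-; congr (multiplier _ F w); apply/funext => s.
  by rewrite big_bool/= mul1r; exact: prod_sub1_expand.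
have E' : multiplier (fun s => N%:R * \prod_i (1 - a i s)) F =
    (fun w => N%:R *: multiplier (fun s => \prod_i (1 - a i s)) F w).
  apply/funext => w.
  have := multiplier_sum (fun _ : 'I_1 => N%:R)
    (fun _ s => \prod_i (1 - a i s)) F w.
  by rewrite big_ord1 => <-; congr (multiplier _ F w); apply/funext => s; rewrite big_ord1.
rewrite -(ler_pM2l Nr0).
have -> : N%:R * lq q (multiplier (fun s => \prod_i (1 - a i s)) F) =
    lq q (multiplier (fun s => N%:R * \prod_i (1 - a i s)) F).
  by rewrite E' [RHS](lqZ q1) (ger0_norm (ltW Nr0)).
rewrite E; apply: le_trans (lqD q1 _ _) _.
rewrite (lqZ q1) normrN normrX normrN1 expr1n mul1r.
have h1 : lq q (multiplier M1 F) <= N%:R / 2 * lq q F.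
  have -> : multiplier M1 F = multiplier (fun s => \prod_(i in B) a i s)
      (fun w => \sum_i (-1) ^+ e i *: multiplier (a i) F w).
    rewrite -multiplierM; congr (multiplier _ _).
    by apply/funext => w; rewrite multiplier_sum.
  by apply: le_trans (bm_lq (b1 B) _) _; rewrite mul1r; exact: he.
apply: le_trans (lerD h1 (bm_lq hb F)) _.
rewrite -mulrDl mulrA ler_wpM2r ?lq_ge0//.
under eq_bigr do under eq_bigr do rewrite normrX normrN1 expr1n mulr1.
have hcard i : \sum_(A : {set 'I_N} | (A != i |: B)%SET) (1 : R) = 2 ^+ N - 1.
  have : \sum_(A : {set 'I_N}) (1 : R) = 2 ^+ N.
    rewrite sumr_const; transitivity (#|{set 'I_N}|%:R : R) => //.
    by rewrite -cardsT -powersetT card_powerset cardsT card_ord natrX.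
  by rewrite (bigD1 (i |: B)%SET)//= => <-; rewrite addrC addrK.
under eq_bigr do rewrite hcard.
rewrite sumr_const card_ord -[X in _ + X]mulr_natl -mulrDr ler_pM2l//.
have half2 : 2^-1 + 2^-1 = 1 :> R by rewrite [RHS](splitr 1) mul1r.
by rewrite lerBrDr addrAC half2 addrC subrK lexx.
Qed.

End TypeToMultiplier.

Lemma sub1_geometric (R : comPzRingType) (x : R) K :
  (1 - x) * \sum_(k < K) x ^+ k = 1 - x ^+ K.
Proof. by rewrite -opprB mulNr -subrX1 opprB. Qed.

(** * Limits of bounded multipliers and Neumann series *)

Section MultiplierLimits.
Context (R : realType) (Y : normedModType R) (n : nat) (q : R).
Hypothesis q1 : 1 <= q.
Implicit Types (m : signs n -> R).
Local Notation bm := (@bounded_multiplier R Y n q).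

Lemma bm_lim_const (c : R) m : (forall e : R, 0 < e -> bm (c + e) m) -> bm c m.
Proof.
move=> h; split=> [s|F].
  by apply/ler_addgt0Pr => e e0; exact: bm_abs (h e e0) s.
have [F0|F0] := eqVneq (lq q F) 0.
  by rewrite F0 mulr0; have := bm_lq (h 1 ltr01) F; rewrite F0 mulr0.
have {}F0 : 0 < lq q F by rewrite lt_def F0 lq_ge0.
rewrite -ler_pdivrMr//; apply/ler_addgt0Pr => e e0.
by rewrite ler_pdivrMr//; exact: bm_lq (h e e0) F.
Qed.

(** An error of 2^-n e in the symbol is a multiplier of norm at most e by [bm_small], since n is
    fixed here. *)
Lemma bm_approx (c : R) m :
  (forall e : R, 0 < e -> exists2 m', bm c m' & forall s, `|m s - m' s| <= e) ->
  bm c m.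
Proof.
move=> h; apply: bm_lim_const => e e0.
have e'0 : 0 < (2 ^+ n)^-1 * e :> R by rewrite mulr_gt0// invr_gt0 exprn_gt0.
have [m' hm' hs] := h _ e'0.
have /(bmD q1 hm') := bm_small Y q1 hs.
rewrite mulrA divff ?expf_neq0// mul1r; apply: bm_ext => s.
by rewrite addrC subrK.
Qed.

Lemma bm_inv_sub1 (g : R) m : 0 <= g -> g < 1 -> bm g m ->
  bm (1 - g)^-1 (fun s => (1 - m s)^-1).
Proof.
move=> g0 g1 hm; have g10 : 0 < 1 - g by rewrite subr_gt0.
have g1n : 1 - g != 0 by rewrite gt_eqF.
apply: bm_approx => e e0.
have [K hK] : exists K, g ^+ K <= e * (1 - g).
  have : (fun k => g ^+ k) @ \oo --> (0 : R) by apply: cvg_expr; rewrite ger0_norm.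
  move/cvgrPdist_le => /(_ (e * (1 - g))); rewrite mulr_gt0// => /(_ isT) [K _ hK].
  exists K; have := hK K (leqnn K).
  by rewrite /= sub0r normrN ger0_norm// exprn_ge0.
exists (fun s => \sum_(k < K) m s ^+ k).
  have h := @bm_sum R Y n q q1 _ xpredT _ _ (fun (k : 'I_K) _ => bmX k hm).
  apply: bm_le h; rewrite -(ler_pM2l g10) divff//.
  rewrite sub1_geometric lerBlDr lerDl exprn_ge0//.
move=> s; have ms := bm_abs hm s.
have m1 : 1 - m s != 0.
  by rewrite gt_eqF// subr_gt0 (le_lt_trans (ler_norm _))// (le_lt_trans ms).
have -> : (1 - m s)^-1 - \sum_(k < K) m s ^+ k = m s ^+ K / (1 - m s).
  apply: (mulfI m1); rewrite mulrBr divff// sub1_geometric.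
  by rewrite mulrCA divff// mulr1 opprB addrC subrK.
rewrite normrM normrX normfV -[leRHS](mulfK g1n) ler_pM ?exprn_ge0 ?invr_ge0//.
  by apply: le_trans hK; rewrite lerXn2r ?nnegrE.
rewrite lef_pV2 ?posrE ?normr_gt0//.
apply: le_trans (lerB_dist _ _); rewrite normr1.
by rewrite lerB.
Qed.

End MultiplierLimits.

(** * Noise operators as mixtures of coordinate projections *)

Section NoiseSemigroup.
Context (R : realType).

Definition weight n (s : signs n) : nat := \sum_i s i.

(** The symbol of the projection a_B: it keeps the characters whose index set misses B. *)
Definition avoids n (B : {set 'I_n}) (s : signs n) : R :=
  \prod_(i in B) (~~ s i)%:R.

Lemma avoids_idem n (B : {set 'I_n}) s : avoids B s * avoids B s = avoids B s.
Proof.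
rewrite /avoids -big_split/=; apply: eq_bigr => i _.
by case: (s i); rewrite ?mulr0 ?mulr1.
Qed.

(** Put each coordinate in B independently with probability 1 - z: the character s then survives a_B
    with probability z^|s|. *)
Lemma exp_weight n (z : R) (s : signs n) :
  z ^+ weight s =
  \sum_(B : {set 'I_n}) (\prod_i (if i \in B then 1 - z else z)) * avoids B s.
Proof.
rewrite -prodrXr.
transitivity (\prod_i ((1 - z) * (~~ s i)%:R + z)).
  by apply: eq_bigr => i _; case: (s i); rewrite /= ?mulr0 ?add0r ?expr1 ?mulr1 ?subrK.
rewrite bigA_distr; apply: eq_bigr => B _.
rewrite /avoids [X in _ * X]big_mkcond -big_split/=; apply: eq_bigr => i _.
by case: (i \in B); rewrite ?mulr1.
Qed.

Lemma sum_prod_mixture n (z : R) :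
  \sum_(B : {set 'I_n}) \prod_i (if i \in B then 1 - z else z) = 1.
Proof. by rewrite -bigA_distr big1// => i _; exact: subrK. Qed.

Section FixedSpace.
Context (Y : normedModType R) (q : R).
Hypothesis q1 : 1 <= q.

(** For a single coordinate the projection is the mean of the identity and of the flip of that
    coordinate. *)
Lemma bm_avoids n (B : {set 'I_n}) : bounded_multiplier Y q 1 (avoids B).
Proof.
apply: bm_prod => // i _.
pose d : signs n := [ffun j => j == i].
have e : `|2^-1| * (1 + 1) = 1 :> R by rewrite ger0_norm ?invr_ge0// mulVf.
rewrite -[X in bounded_multiplier _ _ X _]e.
apply: bm_ext (bmZ q1 2^-1 (bmD q1 (bm1 Y n q) (bm_walsh Y q d))) => s.
rewrite /walsh (bigD1 i)//= big1 ?mulr1; last first.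
  by move=> j /negbTE ji; rewrite ffunE ji andbF.
rewrite ffunE eqxx andbT; case: (s i); rewrite /= ?expr1 ?expr0 ?subrr ?mulr0//.
by rewrite mulVf.
Qed.

Lemma bm_exp_weight n (z : R) : 0 <= z <= 1 ->
  bounded_multiplier Y q 1 (fun s : signs n => z ^+ weight s).
Proof.
move=> /andP[z0 z1].
have h := @bm_sum R Y n q q1 {set 'I_n} xpredT _ _
  (fun B _ => bmZ q1 (\prod_i (if i \in B then 1 - z else z)) (bm_avoids B)).
apply: bm_ext (bm_le _ h) => [s|]; first by rewrite exp_weight.
rewrite -[leRHS](sum_prod_mixture n z) le_eqVlt; apply/orP; left; apply/eqP.
apply: eq_bigr => B _; rewrite mulr1 ger0_norm//; apply: prodr_ge0 => i _.
by case: ifP; rewrite ?subr_ge0.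
Qed.

(** With N independent random sets the N-th power becomes a mixture of products over N possibly
    different sets, and inherits their common bound. *)
Lemma bm_exp_weight_sub1X n N (g z : R) : 0 <= z <= 1 ->
  (forall B : {ffun 'I_N -> {set 'I_n}},
    bounded_multiplier Y q g (fun s => \prod_k (1 - avoids (B k) s))) ->
  bounded_multiplier Y q g (fun s : signs n => (1 - z ^+ weight s) ^+ N).
Proof.
move=> /andP[z0 z1] hg.
pose w (B : {set 'I_n}) := \prod_i (if i \in B then 1 - z else z).
have w0 B : 0 <= w B.
  by apply: prodr_ge0 => i _; case: ifP; rewrite ?subr_ge0.
have h := @bm_sum R Y n q q1 {ffun 'I_N -> {set 'I_n}} xpredT _ _
  (fun B _ => bmZ q1 (\prod_k w (B k)) (hg B)).
apply: bm_ext (bm_le _ h) => [s|].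
  have -> : 1 - z ^+ weight s = \sum_(B : {set 'I_n}) w B * (1 - avoids B s).
    under eq_bigr do rewrite mulrBr mulr1.
    by rewrite sumrB sum_prod_mixture -exp_weight.
  transitivity (\prod_(k < N) \sum_(B : {set 'I_n}) w B * (1 - avoids B s)).
    by rewrite bigA_distr_bigA/=; apply: eq_bigr => B _; rewrite big_split.
  by rewrite prodr_const card_ord.
rewrite -mulr_suml.
have -> : \sum_(B : {ffun 'I_N -> {set 'I_n}}) `|\prod_k w (B k)| = 1.
  under eq_bigr => B _ do rewrite ger0_norm ?prodr_ge0//.
  rewrite -(bigA_distr_bigA (fun _ => w)) big1// => k _.
  exact: sum_prod_mixture.
by rewrite mul1r.
Qed.

End FixedSpace.
End NoiseSemigroup.

(** The condition amounts to 2 C 2^q <= N^(p - 1), which is solvable because p > 1. *)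
Lemma exists_type_size (R : realType) (p q C : R) : 1 < p -> p <= q -> 0 < C ->
  exists2 N : nat, (0 < N)%N & 2 * C * N%:R `^ (q - p) * N%:R <= (N%:R / 2) `^ q.
Proof.
move=> p1 pq C0; have p10 : 0 < p - 1 by rewrite subr_gt0.
have q0 : 0 < q by rewrite (lt_le_trans ltr01)// (le_trans (ltW p1)).
pose a := (2 * C * 2 `^ q) `^ (p - 1)^-1.
have A0 : 0 <= 2 * C * 2 `^ q by rewrite !mulr_ge0 ?powR_ge0 ?(ltW C0).
exists (Num.truncn a).+1 => //; set N : R := (Num.truncn a).+1%:R.
have aN : a <= N by rewrite ltW// truncnS_gt.
have N0 : 0 < N by rewrite ltr0n.
have : 2 * C * 2 `^ q <= N `^ (p - 1).
  have -> : 2 * C * 2 `^ q = a `^ (p - 1).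
    by rewrite /a -powRrM mulVf ?gt_eqF// powRr1.
  by rewrite ge0_ler_powR ?nnegrE ?powR_ge0// ltW.
rewrite -(ler_pM2r (powR_gt0 (q - p + 1) N0)) => h.
rewrite powRM ?(ltW N0)// powRV//.
have -> : N `^ q = N `^ (p - 1) * N `^ (q - p + 1).
  rewrite -powRD; last by rewrite (gt_eqF N0) implybT.
  by congr (_ `^ _); ring.
rewrite ler_pdivlMr ?powR_gt0//; apply: le_trans h.
have -> : N `^ (q - p + 1) = N `^ (q - p) * N.
  by rewrite powRD ?(gt_eqF N0) ?implybT// powRr1// ltW.
rewrite le_eqVlt; apply/orP; left; apply/eqP; ring.
Qed.

(** U = (1 - z^|s|) / 2 is a contraction, and U^N has norm at most g = 1 - 2^-(N + 1). As 1 + z^|s|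
    = 2 (1 - U), its inverse is half of the sum of U^k over k < N, times (1 - U^N)^-1. *)
Lemma bm_inv_add1_exp_weight (R : realType) (Y : normedModType R) (q : R) :
  nontrivial_type Y -> 2 <= q ->
  exists2 C : R, 0 < C & forall n (z : R), 0 <= z <= 1 ->
    bounded_multiplier Y q C (fun s : signs n => (1 + z ^+ weight s)^-1).
Proof.
move=> [p [p1 p2 [K K0 hK]]] q2; have pq := le_trans p2 q2.
have q1 : 1 <= q := le_trans (ltW p1) pq.
have [N N0 hN] := exists_type_size p1 pq K0.
have N2 : 0 < 2 ^+ N :> R by rewrite exprn_gt0.
pose g : R := (2 ^+ N)^-1 * (2 ^+ N - 2^-1).
have gE : g = 1 - 2^-1 / 2 ^+ N.
  by rewrite /g mulrBr mulVf ?gt_eqF// [_^-1 * _]mulrC.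
have g1 : g < 1 by rewrite gE ltrBlDr ltrDl divr_gt0// invr_gt0.
have g0 : 0 <= g.
  rewrite gE subr_ge0 ler_pdivrMr// mul1r (le_trans (y := 1))//.
    by rewrite invf_le1// ler1n.
  by rewrite exprn_ege1// ler1n.
have C0 : 0 < 2^-1 * (N%:R * (1 - g)^-1).
  by rewrite mulr_gt0 ?invr_gt0// mulr_gt0 ?ltr0n// invr_gt0 subr_gt0.
exists (2^-1 * (N%:R * (1 - g)^-1)) => // n z z01.
have hz := @bm_exp_weight R Y q q1 n z z01.
have hU := bmZ q1 2^-1 (bmD q1 (bm1 Y n q) (bmZ q1 (-1) hz)).
have hUN : bounded_multiplier Y q g
    (fun s : signs n => ((1 - z ^+ weight s) / 2) ^+ N).
  have := bmZ q1 (2 ^+ N)^-1 (@bm_exp_weight_sub1X R Y q q1 n N _ z z01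
    (fun B => bm_prod_sub1 p1 pq K0 hK N0 hN (fun k s => avoids_idem R (B k) s)
      (fun k => bm_avoids Y q1 (B k)))).
  rewrite [`|_|]ger0_norm ?invr_ge0 ?(ltW N2)//.
  by apply: bm_ext => s; rewrite expr_div_n mulrC.
have e1 : `|2^-1| * (1 + `|-1| * 1) = 1 :> R.
  by rewrite normrN1 mulr1 ger0_norm ?invr_ge0// mulVf.
rewrite e1 in hU.
have hs := @bm_sum R Y n q q1 'I_N xpredT _ _ (fun k _ => bmX k hU).
have := bmZ q1 2^-1 (bmM hs (bm_inv_sub1 q1 g0 g1 hUN)).
rewrite ger0_norm ?invr_ge0//.
under [in X in X -> _]eq_bigr do rewrite expr1n.
rewrite sumr_const card_ord; apply: bm_ext => s.
set x := z ^+ _.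
have x0 : 0 <= x by rewrite exprn_ge0//; case/andP: z01.
have x1 : 1 + x != 0 by rewrite gt_eqF// ltr_wpDr.
have U1 : (1 - x) / 2 < 1.
  by rewrite ltr_pdivrMr// mul1r ltrBlDr (lt_le_trans (y := 2)) ?ltr1n// lerDl.
have xle1 : x <= 1 by rewrite exprn_ile1//; case/andP: z01.
have UN : 1 - ((1 - x) / 2) ^+ N != 0.
  rewrite gt_eqF// subr_gt0 exprn_ilt1 ?divr_ge0 ?subr_ge0//.
  by rewrite -lt0n.
apply: (mulIf UN); rewrite -!mulrA mulVf// mulr1.
have -> : 2^-1 * (1 + -1 * x) = (1 - x) / 2 by rewrite mulN1r mulrC.
rewrite -(sub1_geometric ((1 - x) / 2)).
set S := \sum_(_ < _) _.
have -> : 1 - (1 - x) / 2 = (1 + x) / 2 by field.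
by field.
Qed.

(** * Trigonometric kernels *)

Section Trigonometry.
Context (R : realType).
Implicit Types (t w x y : R).

Lemma sin_mulrS t k : sin (t *+ k.+2) = 2 * cos t * sin (t *+ k.+1) - sin (t *+ k).
Proof.
rewrite mulrSr [in LHS]sinD.
have -> : t *+ k = t *+ k.+1 - t by rewrite mulrSr addrK.
by rewrite sinB; ring.
Qed.

Lemma cos_mulrS t k : cos (t *+ k.+2) = 2 * cos t * cos (t *+ k.+1) - cos (t *+ k).
Proof.
rewrite mulrSr [in LHS]cosD.
have -> : t *+ k = t *+ k.+1 - t by rewrite mulrSr addrK.
by rewrite cosB; ring.
Qed.

(** Imaginary part of e^(i t) times the geometric sum in w e^(i t), cleared of the denominator |1 -
    w e^(i t)|^2; [cos_geometric] is the real part of the plain geometric sum. *)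
Lemma sin_geometric t w K :
  (1 - 2 * cos t * w + w ^+ 2) * \sum_(i < K) w ^+ i * sin (t *+ i.+1) =
  sin t - w ^+ K * sin (t *+ K.+1) + w ^+ K.+1 * sin (t *+ K).
Proof.
elim: K => [|K IH].
  by rewrite big_ord0 mulr0 expr0 mul1r mulr1n mulr0n sin0 mulr0 subrr addr0.
by rewrite big_ord_recr/= mulrDr IH sin_mulrS !exprS; ring.
Qed.

Lemma cos_geometric t w K :
  (1 - 2 * cos t * w + w ^+ 2) * \sum_(i < K.+1) w ^+ i * cos (t *+ i) =
  1 - w * cos t - w ^+ K.+1 * cos (t *+ K.+1) + w ^+ K.+2 * cos (t *+ K).
Proof.
elim: K => [|K IH].
  by rewrite big_ord1 !mulr0n !mulr1n cos0 expr0 expr1; ring.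
by rewrite big_ord_recr/= mulrDr IH cos_mulrS !exprS; ring.
Qed.

Lemma normr_sin_mulrn t k : `|sin (t *+ k)| <= k%:R * `|sin t|.
Proof.
elim: k => [|k IH]; first by rewrite mulr0n sin0 normr0 mul0r.
rewrite mulrSr sinD -natr1 mulrDl mul1r.
apply: le_trans (ler_normD _ _) _; rewrite !normrM lerD//.
  by apply: le_trans IH; rewrite ler_piMr// cos_max.
by rewrite ler_piMl// cos_max.
Qed.

Lemma sin_le x : 0 <= x -> sin x <= x.
Proof.
rewrite le_eqVlt => /predU1P[<-|x0]; first by rewrite sin0.
have [] := @MVT R sin cos 0 x x0 _ _.
  by apply: continuous_subspaceT; exact: continuous_sin.
move=> c _; rewrite sin0 !subr0 => ->.
by rewrite ler_piMl ?(ltW x0) ?cos_le1.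
Qed.

Lemma cos_piquarter2 : cos (pi / 4 : R) ^+ 2 = 2^-1.
Proof.
have := @cos_mulr2n R (pi / 4).
have -> : (pi / 4 : R) *+ 2 = pi / 2 by field.
rewrite cos_pihalf => h.
apply: (@mulfI _ 2); first by rewrite pnatr_eq0.
rewrite divff ?pnatr_eq0// mulr_natl; apply/eqP.
by rewrite -subr_eq0 -h.
Qed.

(** On [0, pi / 4] the cosine is at least cos (pi / 4). This enters twice in sin x = 2 sin (x / 2)
    cos (x / 2), once through the mean value theorem, and cos^2 (pi / 4) = 1/2. *)
Lemma sin_ge_half x : 0 <= x <= pi / 2 -> x / 2 <= sin x.
Proof.
move=> /andP[]; rewrite le_eqVlt => /predU1P[<- _|x0 xpi].
  by rewrite sin0 mul0r.
have pi4 : pi / 4 = pi / 2 / 2 :> R by field.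
have y0 : 0 < x / 2 by rewrite divr_gt0.
have ypi : x / 2 <= pi / 4 by rewrite pi4 ler_wpM2r.
have c4 : 0 < cos (pi / 4 : R).
  by apply: cos_gt0_pihalf; have := pi_gt0 R => pi0; lra.
have cosge z : 0 <= z -> z <= pi / 4 -> cos (pi / 4) <= cos z.
  move=> z0 zpi; have pi0 := pi_gt0 R.
  by rewrite leNgt ltr_cos ?in_itv/= -?leNgt//; lra.
have [] := @MVT R sin cos 0 (x / 2) y0 _ _.
  by apply: continuous_subspaceT; exact: continuous_sin.
move=> c /[!in_itv]/= /andP[c0 cx]; rewrite sin0 !subr0 => e.
have -> : sin x = 2 * (sin (x / 2) * cos (x / 2)).
  have {1}-> : x = (x / 2) *+ 2 by field.
  by rewrite sin_mulr2n; ring.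
rewrite e.
have E : x / 2 = 2 * (cos (pi / 4) * (x / 2) * cos (pi / 4)).
  by rewrite mulrAC -expr2 cos_piquarter2; field.
rewrite [leLHS]E.
have h1 : cos (pi / 4) * (x / 2) <= cos c * (x / 2).
  by rewrite (ler_wpM2r (ltW y0))// cosge ?(ltW c0)// (le_trans (ltW cx)).
have h2 : cos (pi / 4) <= cos (x / 2) by rewrite cosge// ltW.
rewrite ler_wpM2l//; by apply: ler_pM h1 h2; rewrite ?mulr_ge0// ltW.
Qed.

End Trigonometry.

(** One summation by parts: applied to first differences of resolvents, it leaves two end terms and
    second differences. *)
Lemma alternating_sum2 (R : comPzRingType) (d : nat -> R) H :
  2 * \sum_(j < H.+1) (-1) ^+ j * d j =
  d 0%N + (-1) ^+ H * d H + \sum_(j < H) (-1) ^+ j * (d j - d j.+1).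
Proof.
elim: H => [|H IH]; first by rewrite big_ord1 big_ord0 expr0; ring.
by rewrite big_ord_recr/= mulrDr IH big_ord_recr/= exprS; ring.
Qed.

(** * Poisson kernels at the angles pi j / H *)

Section AlternatingResolvents.
Context (R : realType).
Implicit Types (w : R) (H j k : nat).

Definition gap H j : R := 1 - cos ((pi / H%:R) *+ j).

(* The kernel (1 - w)^2 / |1 - w e^(i theta)|^2 at theta = pi j / H, with its
   limit value at theta = 0 so that it is also correct at w = 1. *)
Definition resolvent H w j : R :=
  if j is 0 then 1 else (1 - w) ^+ 2 / ((1 - w) ^+ 2 + 2 * w * gap H j).

Arguments resolvent : simpl never.

Lemma piH_mulrn H k : (0 < H)%N -> (pi / H%:R) *+ (k * H) = pi *+ k :> R.
Proof.
move=> H0; rewrite mulnC mulrnA -[_ *+ H]mulr_natr divfK//.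
by rewrite pnatr_eq0 -lt0n.
Qed.

Lemma cos_pi_mulrn k : cos (pi *+ k : R) = (-1) ^+ k.
Proof.
elim: k => [|k IH]; first by rewrite mulr0n cos0.
by rewrite mulrSr cosDpi IH exprS mulN1r.
Qed.

Lemma sin_pi_mulrn k : sin (pi *+ k : R) = 0.
Proof.
elim: k => [|k IH]; first by rewrite mulr0n sin0.
by rewrite mulrSr sinDpi IH oppr0.
Qed.

Lemma cosD_pi_mulrn (x : R) k : cos (x + pi *+ k) = (-1) ^+ k * cos x.
Proof. by rewrite cosD cos_pi_mulrn sin_pi_mulrn mulr0 subr0 mulrC. Qed.

Lemma gap_gt0 H j : (0 < j <= H)%N -> 0 < gap H j.
Proof.
move=> /andP[j0 jH]; have H0 := leq_trans j0 jH.
have Hr : 0 < H%:R :> R by rewrite ltr0n.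
rewrite /gap subr_gt0 -[ltRHS](cos0 R) ltr_cos ?in_itv/= ?lexx ?pi_ge0//.
  by rewrite mulrn_wgt0 ?divr_gt0 ?pi_gt0.
rewrite mulrn_wge0 ?divr_ge0 ?pi_ge0//= -mulr_natr mulrAC ler_pdivrMr//.
by rewrite ler_wpM2l ?pi_ge0// ler_nat.
Qed.

(** The gap is 2 sin^2 of half the angle, hence comparable with (j / H)^2. With [gap1_le] this makes
    the ratio of gap 1 to gap j of order j^-2, the source of all summability below. *)
Lemma gap_ge H j : (0 < H)%N -> (j <= H)%N ->
  j%:R ^+ 2 / (2 * H%:R ^+ 2) <= gap H j.
Proof.
move=> H0 jH; have Hr : 0 < H%:R :> R by rewrite ltr0n.
pose y : R := pi / H%:R * j%:R / 2.
have y0 : 0 <= y by rewrite !mulr_ge0 ?pi_ge0 ?invr_ge0.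
have ypi : y <= pi / 2.
  rewrite ler_wpM2r// mulrAC ler_pdivrMr//.
  by rewrite ler_wpM2l ?pi_ge0// ler_nat.
have -> : gap H j = 2 * sin y ^+ 2.
  rewrite /gap; have -> : (pi / H%:R) *+ j = y *+ 2 by rewrite /y; field; rewrite gt_eqF.
  by rewrite cos_mulr2n sin2cos2; ring.
have yH : j%:R / H%:R <= y.
  have -> : y = (pi / 2) * (j%:R / H%:R) by rewrite /y; field; rewrite gt_eqF.
  by rewrite ler_peMl ?divr_ge0// ler_pdivlMr// mul1r pi_ge2.
have sy : j%:R / H%:R / 2 <= sin y.
  apply: (le_trans (y := y / 2)); first by rewrite ler_wpM2r.
  by apply: sin_ge_half; rewrite y0.
have -> : j%:R ^+ 2 / (2 * H%:R ^+ 2) = 2 * (j%:R / H%:R / 2) ^+ 2 :> R.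
  by field; rewrite gt_eqF.
by rewrite ler_wpM2l// lerXn2r ?nnegrE ?divr_ge0// (le_trans _ sy) ?divr_ge0.
Qed.

Lemma gap1_le H : (0 < H)%N -> gap H 1 <= 8 / H%:R ^+ 2.
Proof.
move=> H0; have Hr : 0 < H%:R :> R by rewrite ltr0n.
pose y : R := pi / H%:R / 2.
have y0 : 0 <= y by rewrite !mulr_ge0 ?pi_ge0 ?invr_ge0.
have y2 : y <= 2 / H%:R.
  by rewrite /y mulrAC ler_wpM2r ?invr_ge0// ltW// pihalf_lt2.
have -> : gap H 1 = 2 * sin y ^+ 2.
  rewrite /gap; have -> : (pi / H%:R) *+ 1 = y *+ 2 by rewrite /y; field; rewrite gt_eqF.
  by rewrite cos_mulr2n sin2cos2; ring.
have -> : 8 / H%:R ^+ 2 = 2 * (2 / H%:R) ^+ 2 :> R by field; rewrite gt_eqF.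
rewrite ler_wpM2l// lerXn2r ?nnegrE ?divr_ge0//; last exact: le_trans (sin_le y0) y2.
rewrite sin_ge0_pi// y0 /y -mulrA ler_piMr ?pi_ge0//.
by rewrite -invfM invf_le1 ?mulr_gt0// -natrM ler1n muln_gt0 H0.
Qed.

(* 2 cos x cos j x = cos (j + 1) x + cos (j - 1) x controls both the sum and
   the product of the increments of the gap at j. *)
Lemma gap_second_difference H j :
  gap H j.+2 + gap H j - 2 * gap H j.+1 = 2 * (1 - gap H j.+1) * gap H 1.
Proof. by rewrite /gap cos_mulrS mulr1n; ring. Qed.

Lemma gap_increments H j :
  (gap H j.+2 - gap H j.+1) * (gap H j.+1 - gap H j) =
  gap H 1 * (gap H j.+1 * (2 - gap H j.+1) * (2 - gap H 1) -
             (1 - gap H j.+1) ^+ 2 * gap H 1).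
Proof.
rewrite /gap mulr1n; set t := pi / H%:R; set c := cos (t *+ j.+1).
have -> : t *+ j.+2 = t *+ j.+1 + t by rewrite mulrSr.
have -> : t *+ j = t *+ j.+1 - t by rewrite mulrSr addrK.
rewrite cosD cosB -/c; set s := sin (t *+ j.+1).
have s2 : s ^+ 2 = 1 - c ^+ 2 by exact: sin2cos2.
have t2 : sin t ^+ 2 = 1 - cos t ^+ 2 by exact: sin2cos2.
have -> : (1 - (c * cos t - s * sin t) - (1 - c)) *
    (1 - c - (1 - (c * cos t + s * sin t))) =
    s ^+ 2 * sin t ^+ 2 - c ^+ 2 * (1 - cos t) ^+ 2 by ring.
by rewrite s2 t2; ring.
Qed.

(** Adding pi to the angle absorbs the alternating sign. Times 1 - cos psi the sum telescopes to a
    multiple of sin (H psi) = 0, and for k < 2 H the factor 1 - cos psi vanishes only at k = H. *)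
Lemma sum_alternating_cos H k : (0 < H)%N -> (k < H.*2)%N ->
  \sum_(j < H) (-1) ^+ j * (cos ((pi / H%:R) *+ (k * j)) - cos ((pi / H%:R) *+ (k * j.+1)))
  = 2 * H%:R * (k == H)%:R :> R.
Proof.
move=> H0 kH; have Hr : 0 < H%:R :> R by rewrite ltr0n.
set d : R := pi / H%:R; pose psi := d *+ k + pi.
have psiE j : cos (psi *+ j) = (-1) ^+ j * cos (d *+ (k * j)).
  by rewrite mulrnDl -mulrnA cosD_pi_mulrn.
transitivity (\sum_(j < H) (cos (psi *+ j) + cos (psi *+ j.+1))).
  apply: eq_bigr => j _; rewrite !psiE exprS; ring.
have [kE|kH'] := eqVneq k H.
  have psi2 : cos psi = 1.
    by rewrite /psi kE -[X in _ *+ X](mul1n H) piH_mulrn// mulr1n -mulr2n cos2pi.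
  have c1 j : cos (psi *+ j) = 1.
    rewrite psiE kE mulnC piH_mulrn// cos_pi_mulrn -exprD addnn -mul2n exprM.
    by rewrite sqrrN expr1n expr1n.
  under eq_bigr do rewrite !c1.
  by rewrite sumr_const card_ord mulr1 -[LHS]mulr_natr.
rewrite mulr0.
have tele : (1 - cos psi) * \sum_(j < H) (cos (psi *+ j) + cos (psi *+ j.+1)) = 0.
  rewrite mulr_sumr.
  transitivity (sin psi * \sum_(j < H) (sin (psi *+ j.+1) - sin (psi *+ j))).
    rewrite mulr_sumr; apply: eq_bigr => j _.
    rewrite mulrSr [cos (psi *+ j + psi)]cosD [sin (psi *+ j + psi)]sinD.
    have : sin psi ^+ 2 = 1 - cos psi ^+ 2 by exact: sin2cos2.
    move: (sin psi) (cos psi) (sin (psi *+ j)) (cos (psi *+ j)) => S C s c e.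
    apply/eqP; rewrite -subr_eq0; apply/eqP.
    transitivity (- c * (S ^+ 2 - (1 - C ^+ 2))); first by ring.
    by rewrite e subrr mulr0.
  have -> : \sum_(j < H) (sin (psi *+ j.+1) - sin (psi *+ j)) = sin (psi *+ H).
    rewrite -(big_mkord xpredT (fun j => sin (psi *+ j.+1) - sin (psi *+ j))).
    by rewrite telescope_sumr// mulr0n sin0 subr0.
  by rewrite /psi mulrnDl -mulrnA piH_mulrn// -mulrnDr sin_pi_mulrn mulr0.
have n1 : 1 - cos psi != 0.
  rewrite /psi cosDpi opprK.
  have [kl|kl] := ltnP k H.
    rewrite gt_eqF// -ltrBlDl sub0r -(cospi R) ltr_cos ?in_itv/= ?lexx ?pi_ge0//; last first.
      rewrite mulrn_wge0 ?divr_ge0 ?pi_ge0//= -mulr_natr mulrAC ler_pdivrMr//.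
      by rewrite ler_wpM2l ?pi_ge0// ler_nat ltnW.
    by rewrite -mulr_natr mulrAC ltr_pdivrMr// ltr_pM2l ?pi_gt0// ltr_nat.
  have {kl} kl : (H < k)%N by rewrite ltn_neqAle eq_sym kH'.
  have -> : cos (d *+ k) = cos (d *+ (H.*2 - k)).
    rewrite mulrnBr ?(ltnW kH)// -mul2n piH_mulrn//.
    by rewrite cosB cos2pi sin2pi mul1r mul0r addr0.
  have kl2 : (H.*2 - k < H)%N by rewrite ltn_subLR ?(ltnW kH)// -addnn ltn_add2r.
  rewrite gt_eqF// -ltrBlDl sub0r -(cospi R) ltr_cos ?in_itv/= ?lexx ?pi_ge0//; last first.
    rewrite mulrn_wge0 ?divr_ge0 ?pi_ge0//= -mulr_natr mulrAC ler_pdivrMr//.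
    by rewrite ler_wpM2l ?pi_ge0// ler_nat ltnW.
  by rewrite -mulr_natr mulrAC ltr_pdivrMr// ltr_pM2l ?pi_gt0// ltr_nat.
by move/eqP: tele; rewrite mulf_eq0 (negbTE n1) => /eqP.
Qed.

Lemma gap_ge0 H j : 0 <= gap H j.
Proof. by rewrite subr_ge0 cos_le1. Qed.

(** Fourier series of the Poisson kernel (1 - w^2) / |1 - w e^(i theta)|^2, folded by periodicity
    into the 2 H frequencies visible at theta = pi j / H and cleared of denominators. *)
Lemma resolvent_fourier H w j : (0 < H)%N -> 0 < w -> w < 1 ->
  resolvent H w j * ((1 + w) * (1 - w ^+ H.*2)) =
  (1 - w) * (2 * (\sum_(k < H.*2) w ^+ k * cos ((pi / H%:R) *+ (k * j))) -
             (1 - w ^+ H.*2)).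
Proof.
move=> H0 w0 w1; set t : R := (pi / H%:R) *+ j.
have w1' : 1 - w != 0 by rewrite subr_eq0 gt_eqF.
set D := 1 - 2 * cos t * w + w ^+ 2.
have DE : D = (1 - w) ^+ 2 + 2 * w * gap H j by rewrite /D /gap -/t; ring.
have D0 : D != 0.
  rewrite DE gt_eqF// ltr_pwDl ?mulr_ge0 ?gap_ge0 ?(ltW w0)//.
  by rewrite lt_def sqrf_eq0 w1' sqr_ge0.
have -> : resolvent H w j = (1 - w) ^+ 2 / D.
  rewrite DE; case: {t D DE D0} j => //=.
  by rewrite /gap mulr0n cos0 subrr mulr0 addr0 divff// sqrf_eq0.
have [M ME] : exists M, H.*2 = M.+1 by exists H.*2.-1; rewrite prednK// double_gt0.
have tM : t *+ M.+1 = pi *+ j.*2.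
  have jE : (j * H.*2 = j.*2 * H)%N by rewrite -!muln2 mulnA mulnAC.
  by rewrite -mulrnA -ME jE piH_mulrn.
have c1 : cos (t *+ M.+1) = 1.
  by rewrite tM cos_pi_mulrn -mul2n exprM sqrrN expr1n expr1n.
have c2 : cos (t *+ M) = cos t.
  have -> : t *+ M = pi *+ j.*2 - t by rewrite -tM mulrSr addrK.
  by rewrite addrC cosD_pi_mulrn cosN -mul2n exprM sqrrN expr1n expr1n mul1r.
have := cos_geometric t w M; rewrite c1 c2 -/D => e.
have -> : \sum_(k < H.*2) w ^+ k * cos ((pi / H%:R) *+ (k * j)) =
    \sum_(i < M.+1) w ^+ i * cos (t *+ i).
  by rewrite ME; apply: eq_bigr => k _; rewrite -mulrnA mulnC.
rewrite ME; apply: (mulfI D0).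
have cancelD (a b : R) : D * (a / D * b) = a * b by rewrite mulrA mulrCA divff ?mulr1.
rewrite cancelD; set S := \sum_(_ < _) _ in e *.
transitivity ((1 - w) * (2 * (D * S) - D * (1 - w ^+ M.+1))); last by ring.
by rewrite e /D !exprS; ring.
Qed.

(** Only the frequency k = H survives. At w = exp (- t x / H) the factor H w^H (1 - w) tends to t x
    exp (- t x), the symbol wanted. *)
Lemma resolvent_alternating_sum H w : (0 < H)%N -> 0 < w -> w <= 1 ->
  (\sum_(j < H) (-1) ^+ j * (resolvent H w j - resolvent H w j.+1)) *
  ((1 + w) * (1 - w ^+ H.*2)) = 4 * H%:R * w ^+ H * (1 - w).
Proof.
move=> H0 w0; rewrite le_eqVlt => /predU1P[->|w1].
  by rewrite expr1n subrr !mulr0.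
rewrite mulr_suml.
transitivity (2 * (1 - w) * \sum_(k < H.*2) w ^+ k * (2 * H%:R * (k == H :> nat)%:R)).
  under [in RHS]eq_bigr => k _ do rewrite -(sum_alternating_cos H0 (ltn_ord k)) mulr_sumr.
  rewrite exchange_big/= mulr_sumr; apply: eq_bigr => j _.
  rewrite -mulrA mulrBl !resolvent_fourier//.
  set A := \sum_(k < _) _ * cos (_ *+ (k * j)).
  set B := \sum_(k < _) _ * cos (_ *+ (k * j.+1)).
  have -> : \sum_(k < H.*2) w ^+ k * ((-1) ^+ j *
      (cos ((pi / H%:R) *+ (k * j)) - cos ((pi / H%:R) *+ (k * j.+1)))) =
      (-1) ^+ j * (A - B).
    by rewrite -sumrB mulr_sumr; apply: eq_bigr => k _; ring.
  by ring.
have HM : (H < H.*2)%N by rewrite -addnn -[ltnLHS]addn0 ltn_add2l.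
rewrite (bigD1 (Ordinal HM))//= eqxx mulr1 big1 ?addr0; first by ring.
move=> k kH; have /negbTE -> : (k : nat) != H by apply: contraNneq kH => kE; apply/eqP/val_inj.
by rewrite !mulr0.
Qed.

End AlternatingResolvents.

Arguments resolvent : simpl never.

(** * Bounded resolvents *)

Lemma cvg_difference_quotient (R : realType) (f : R -> R) (d : R) (h : R^nat) :
  is_derive (0 : R) 1 f d -> f 0 = 0 -> (forall k, h k != 0) ->
  h k @[k --> \oo] --> 0 -> f (h k) / h k @[k --> \oo] --> d.
Proof.
move=> df f0 h0 hc.
have : h^-1 *: ((f \o shift 0) (h *: 1) - f 0) @[h --> 0^'] --> d.
  by have := @ex_derive _ _ _ _ _ _ _ df; rewrite /derivable -(@derive_val _ _ _ _ _ _ _ df).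
move/cvgr_dnbhsP => /(_ h (conj h0 hc)).
apply: cvg_trans; apply: near_eq_cvg; near=> k => /=.
by rewrite f0 subr0 addr0 mulrC [_ *: 1]mulr1.
Unshelve. all: by end_near. Qed.

Lemma cvg_sub1_expR_quotient (R : realType) (x : R) (h : R^nat) :
  (forall k, h k != 0) -> h k @[k --> \oo] --> 0 ->
  (1 - expR (- (h k * x))) / h k @[k --> \oo] --> x.
Proof.
move=> h0 hc; have df : is_derive (0 : R) 1 (fun y : R => 1 - expR (- (y * x))) x.
  apply: is_derive_eq; rewrite mul0r oppr0 expR0.
  by rewrite scaler0 !add0r !mul1r opprK [_ *: 1]mulr1.
apply: (cvg_difference_quotient df _ h0 hc).
by rewrite mul0r oppr0 expR0 subrr.
Qed.

Lemma cvg_sin_quotient (R : realType) (a : R) (h : R^nat) :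
  (forall k, h k != 0) -> h k @[k --> \oo] --> 0 ->
  sin (h k * a) / h k @[k --> \oo] --> a.
Proof.
move=> h0 hc; have df : is_derive (0 : R) 1 (fun y : R => sin (y * a)) a.
  by apply: is_derive_eq; rewrite mul0r cos0 scaler0 !add0r !mul1r ?[_ *: 1]mulr1.
apply: (cvg_difference_quotient df _ h0 hc).
by rewrite mul0r sin0.
Qed.

Lemma cvg_expR_to1 (R : realType) (x : R) (h : R^nat) :
  (forall k, h k != 0) -> h k @[k --> \oo] --> 0 ->
  expR (- (h k * x)) @[k --> \oo] --> (1 : R).
Proof.
move=> h0 hc; have hx := @cvg_sub1_expR_quotient R x h h0 hc.
have -> : (fun k => expR (- (h k * x))) =
    (fun k => 1 - (1 - expR (- (h k * x))) / h k * h k).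
  by apply/funext => k; rewrite divfK// opprB addrC subrK.
rewrite -[X in _ --> X]subr0 -[X in _ --> _ - X](mulr0 x).
by apply: cvgB; [exact: cvg_cst|exact: cvgM].
Qed.

Lemma sum_inv_sqr_le1 (R : realType) (m : nat) :
  \sum_(j < m) (j.+2%:R ^+ 2)^-1 <= 1 :> R.
Proof.
suff h : \sum_(j < m) (j.+2%:R ^+ 2)^-1 <= 1 - m.+1%:R^-1 :> R.
  by apply: le_trans h _; rewrite lerBlDr lerDl invr_ge0.
elim: m => [|m IH]; first by rewrite big_ord0 invr1 subrr.
rewrite big_ord_recr/=; apply: le_trans (lerD IH (lexx _)) _.
rewrite -addrA lerD2l -[leRHS]opprK -lerNr opprD !opprK.
have -> : (m.+2%:R : R) = m.+1%:R + 1 by rewrite natr1.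
have : 0 < m.+1%:R :> R by [].
move: (m.+1%:R : R) => u u0; have u10 : 0 < u + 1 by rewrite addr_gt0.
rewrite -subr_ge0.
have -> : u^-1 - ((u + 1) ^+ 2)^-1 - (u + 1)^-1 = (u * (u + 1) ^+ 2)^-1.
  by field; rewrite !gt_eqF.
by rewrite invr_ge0 mulr_ge0 ?sqr_ge0 ?(ltW u0).
Qed.

(** Every term keeps one bounded quotient a / (a + 2 w g0). In the application [s] is of order gap 1
    and [p] of order gap 1 times the middle gap, so after division by the gaps both terms are of
    order gap 1 over the last gap. *)
Lemma resolvent_second_difference (R : fieldType) (a w g0 g1 g2 s p : R) :
  a + 2 * w * g0 != 0 -> a + 2 * w * g1 != 0 -> a + 2 * w * g2 != 0 ->
  g2 + g0 - 2 * g1 = s -> (g2 - g1) * (g1 - g0) = p ->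
  a / (a + 2 * w * g0) - a / (a + 2 * w * g1) -
    (a / (a + 2 * w * g1) - a / (a + 2 * w * g2)) =
  - (2 * s) * (w * (a / (a + 2 * w * g0) * (a + 2 * w * g2)^-1)) +
  8 * p * (w ^+ 2 * (a / (a + 2 * w * g0) *
    ((a + 2 * w * g1)^-1 * (a + 2 * w * g2)^-1))).
Proof. by move=> D0 D1 D2 <- <-; field; rewrite D0 D1 D2. Qed.

Lemma expR_gridX (R : realType) (t y : R) (k : nat) :
  expR (- (t / k.+1%:R * y)) ^+ k.+1 = expR (- (t * y)).
Proof.
rewrite -expRM_natl mulrN mulrA.
have -> : k.+1%:R * (t / k.+1%:R) = t by rewrite mulrC divfK.
by [].
Qed.

(** * From inverses of 1 + P_t to the derivative of the semigroup *)

Section AnalyticSemigroup.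
Context (R : realType) (Y : normedModType R) (n : nat) (q : R).
Hypothesis q1 : 1 <= q.
Implicit Types (m : signs n -> R).
Local Notation bm := (@bounded_multiplier R Y n q).

(** The cube is finite, so pointwise convergence is uniform and [bm_approx] applies without loss in
    c. *)
Lemma bm_cvg (c : R) (m_ : nat -> signs n -> R) m :
  (\forall k \near \oo, bm c (m_ k)) ->
  (forall s, m_ k s @[k --> \oo] --> m s) -> bm c m.
Proof.
move=> hb hc; apply: (bm_approx q1) => e e0.
have : \forall k \near \oo, forall s, `|m s - m_ k s| <= e.
  by apply: filter_forall => s; move/cvgrPdist_le: (hc s); exact.
move=> hs; have [k [hk1 hk2]] := @filter_ex _ _ _ _ (filterI hb hs).
by exists (m_ k).
Qed.

Variable (x : signs n -> R) (C : R).
Hypothesis x0 : forall s, 0 <= x s.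
Hypothesis bm_exp : forall t : R, 0 <= t -> bm 1 (fun s => expR (- (t * x s))).
Hypothesis bm_fermi : forall t : R, 0 <= t ->
  bm C (fun s => (1 + expR (- (t * x s)))^-1).

Let C0 : 0 <= C := bm_ge0 (bm_fermi (lexx 0)).

(** The denominator divides 1 + w^J, with roots exp (± i pi / J). The cofactor has J - 1
    coefficients sin ((i + 1) pi / J) / sin (pi / J), each at most J, whence J^2; the inverse of 1 +
    w^J is [bm_fermi] at time J tau. *)
Lemma bm_discrete_resolvent (J : nat) (tau : R) : 0 <= tau -> (1 < J)%N ->
  bm (C * J%:R ^+ 2) (fun s => (1 - 2 * cos (pi / J%:R) * expR (- (tau * x s)) +
     expR (- (tau * x s)) ^+ 2)^-1).
Proof.
move=> tau0; case: J => [//|[//|K]] _; set J := K.+2; set t : R := pi / J%:R.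
have Jr : 0 < J%:R :> R by rewrite ltr0n.
have tJ : t *+ K.+2 = pi by rewrite -[LHS]mulr_natr divfK ?gt_eqF.
have tJ1 : t *+ K.+1 = pi - t by rewrite -tJ [in RHS]mulrSr addrK.
have st0 : 0 < sin t.
  apply: sin_gt0_pi; rewrite divr_gt0 ?pi_gt0//= /t ltr_pdivrMr// ltr_pMr ?pi_gt0//.
  by rewrite ltr1n.
have hS := @bm_sum R Y n q q1 'I_K.+1 xpredT _ _
  (fun i _ => bmZ q1 (sin (t *+ i.+1) / sin t) (bmX i (bm_exp tau0))).
have hb : bm C (fun s => (1 + expR (- (tau * x s)) ^+ J)^-1).
  have JT : 0 <= J%:R * tau by rewrite mulr_ge0.
  by apply: bm_ext (bm_fermi JT) => s; rewrite -expRM_natl mulrN mulrA.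
apply: bm_ext (bm_le _ (bmM hb hS)) => [s|].
  set w := expR _.
  have w0 : 0 < w by exact: expR_gt0.
  set D := 1 - _ + _; set S := \sum_(_ < _) _.
  have DS : D * S = 1 + w ^+ J.
    have := sin_geometric t w K.+1; rewrite tJ tJ1 sinpi.
    have -> : sin (pi - t) = sin t by rewrite sinB sinpi cospi; ring.
    have -> : \sum_(i < K.+1) w ^+ i * sin (t *+ i.+1) = sin t * S.
      rewrite /S mulr_sumr; apply: eq_bigr => i _; field; rewrite ?gt_eqF//.
    rewrite mulr0 subr0 -/D => h.
    have st1 : sin t != 0 by rewrite gt_eqF.
    apply: (mulfI st1).
    by rewrite mulrCA h; ring.
  have w1 : 1 + w ^+ J != 0 by rewrite gt_eqF// ltr_pwDl// exprn_ge0// ltW.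
  have D0 : D != 0 by apply: contra_neq w1 => D0; rewrite -DS D0 mul0r.
  by rewrite -DS invfM -mulrA mulVf ?mulr1//; apply: contra_neq w1 => S0; rewrite -DS S0 mulr0.
rewrite ler_wpM2l// (le_trans (y := \sum_(i < K.+1) (J%:R : R)))//.
  apply: ler_sum => i _; rewrite expr1n mulr1 normrM normfV ler_pdivrMr ?normr_gt0 ?gt_eqF//.
  apply: le_trans (normr_sin_mulrn t i.+1) _; rewrite ler_wpM2r// ler_nat.
  by rewrite (leq_trans (ltn_ord i)).
rewrite sumr_const card_ord -[leLHS]mulr_natl expr2 ler_wpM2r ?(ltW Jr)// ler_nat.
by rewrite leqnSn.
Qed.

Lemma bm_resolvent (mu : R) : 0 < mu ->
  bm (C * pi ^+ 2) (fun s => mu / (x s ^+ 2 + mu)).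
Proof.
move=> mu0; pose lam := Num.sqrt mu.
have lam0 : 0 < lam by rewrite sqrtr_gt0.
have lam2 : lam ^+ 2 = mu by rewrite sqr_sqrtr// ltW.
(* The angle pi / J equals lam h for J = k + 2, so the denominator is h^2 (x^2 + lam^2) to leading
   order, while h^2 J^2 = pi^2 / mu cancels the growth of the bound. *)
pose h (k : nat) : R := pi / (lam * k.+2%:R).
have h0 k : 0 < h k by rewrite divr_gt0 ?pi_gt0// mulr_gt0.
have hn0 k : h k != 0 by rewrite gt_eqF.
have hc : h k @[k --> \oo] --> 0.
  have -> : h = (fun k => (pi / lam) * (k.+2%:R)^-1).
    by apply/funext => k; rewrite /h invfM mulrA.
  rewrite -(mulr0 (pi / lam)); apply: cvgM; first exact: cvg_cst.
  by have := @cvg_harmonic R; rewrite -cvg_shiftS.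
pose w k s := expR (- (h k * x s)).
apply: (@bm_cvg _ (fun k s => (mu * h k ^+ 2) *
    (1 - 2 * cos (pi / k.+2%:R) * w k s + w k s ^+ 2)^-1)).
  apply: nearW => k.
  have hk := bmZ q1 (mu * h k ^+ 2) (@bm_discrete_resolvent k.+2 (h k) (ltW (h0 k)) isT).
  have c0 : 0 <= mu * h k ^+ 2 := mulr_ge0 (ltW mu0) (sqr_ge0 _).
  have e : `|mu * h k ^+ 2| * (C * k.+2%:R ^+ 2) = C * pi ^+ 2.
    rewrite (ger0_norm c0) -lam2 /h; have : k.+2%:R != 0 :> R by [].
    by move: (k.+2%:R : R) => r r0; field; rewrite r0 gt_eqF.
  by rewrite e in hk.
move=> s.
have D k : (mu * h k ^+ 2) * (1 - 2 * cos (pi / k.+2%:R) * w k s + w k s ^+ 2)^-1 =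
   mu / (((1 - w k s) / h k) ^+ 2 + w k s * (4 * (sin (h k * (lam / 2)) / h k) ^+ 2)).
  have -> : cos (pi / k.+2%:R) = 1 - 2 * sin (h k * (lam / 2)) ^+ 2.
    have -> : pi / k.+2%:R = (h k * (lam / 2)) *+ 2 :> R.
      rewrite /h; have : k.+2%:R != 0 :> R by [].
      by move: (k.+2%:R : R) => r r0; field; rewrite r0 gt_eqF.
    by rewrite cos_mulr2n cos2sin2; ring.
  rewrite -mulrA; congr (_ * _).
  rewrite -[X in X * _]invrK -invfM; congr (_^-1).
  by field.
rewrite (funext D).
have hx := @cvg_sub1_expR_quotient R (x s) h hn0 hc.
have hs := @cvg_sin_quotient R (lam / 2) h hn0 hc.
have hw : w k s @[k --> \oo] --> (1 : R) by exact: cvg_expR_to1.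
have E : x s ^+ 2 + mu = x s ^+ 2 + 1 * (4 * (lam / 2) ^+ 2).
  by rewrite -lam2; field.
apply: cvgM; first exact: cvg_cst.
apply: cvgV; first by rewrite gt_eqF// ltr_wpDl// sqr_ge0.
rewrite E; apply: cvgD.
  by under eq_fun do rewrite expr2; rewrite expr2; exact: cvgM.
apply: cvgM => //; apply: cvgM; first exact: cvg_cst.
by under eq_fun do rewrite expr2; rewrite expr2; exact: cvgM.
Qed.

Let C1 : R := C * pi ^+ 2.

Let C1_ge0 : 0 <= C1.
Proof. by rewrite mulr_ge0// sqr_ge0. Qed.

(* On the grid of step t / H the resolvents in the variable exp (- (t x / H))
   are small perturbations of resolvents in x, uniformly in the angle. *)
Lemma bm_gap_resolvent (t : R) : 0 < t -> \forall k \near \oo, forall j,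
  (0 < j <= k.+1)%N ->
  bm (C1 / gap R k.+1 j) (fun s => ((1 - expR (- (t / k.+1%:R * x s))) ^+ 2 +
    2 * expR (- (t / k.+1%:R * x s)) * gap R k.+1 j)^-1).
Proof.
move=> t0; pose h (k : nat) : R := t / k.+1%:R.
have h0 k : 0 < h k by rewrite divr_gt0.
have hn0 k : h k != 0 by rewrite gt_eqF.
have hc : h k @[k --> \oo] --> 0.
  rewrite -(mulr0 t); apply: cvgM; first exact: cvg_cst.
  exact: (@cvg_harmonic R).
pose w k s := expR (- (h k * x s)).
(* A pointwise error below eta, after the factor 2^n of [bm_small] and the resolvent bound C1, has
   norm at most 1/2, as the Neumann series requires. *)
pose eta : R := (2 ^+ n * (C1 + 1) * 2)^-1.
have C11 : 0 < C1 + 1 by rewrite ltr_wpDl.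
have eta0 : 0 < eta by rewrite invr_gt0 !mulr_gt0// exprn_gt0.
have etaC : 2 ^+ n * eta * C1 <= 2^-1.
  have -> : 2 ^+ n * eta * C1 = C1 / (C1 + 1) / 2.
    rewrite /eta; have : 2 ^+ n != 0 :> R by rewrite expf_neq0.
    move: (2 ^+ n : R) => N N0; field; rewrite N0.
    by rewrite gt_eqF.
  by rewrite ler_piMl// ler_pdivrMr// mul1r lerDl.
have : \forall k \near \oo, forall s,
    `|x s ^+ 2 - ((1 - w k s) / h k) ^+ 2| * t ^+ 2 + `|1 - w k s| <= eta.
  apply: filter_forall => s.
  have hx := @cvg_sub1_expR_quotient R (x s) h hn0 hc.
  have hw : w k s @[k --> \oo] --> (1 : R) by exact: cvg_expR_to1.
  have hz : `|x s ^+ 2 - ((1 - w k s) / h k) ^+ 2| * t ^+ 2 + `|1 - w k s|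
      @[k --> \oo] --> `|x s ^+ 2 - x s ^+ 2| * t ^+ 2 + `|1 - 1 : R|.
    apply: cvgD; last by apply: cvg_norm; apply: cvgB => //; exact: cvg_cst.
    apply: cvgM; last exact: cvg_cst.
    apply: cvg_norm; apply: cvgB; first exact: cvg_cst.
    by under eq_fun do rewrite expr2; rewrite expr2; exact: cvgM.
  rewrite !subrr normr0 mul0r addr0 in hz.
  move/cvgrPdist_le: hz => /(_ eta eta0); apply: filterS => k.
  by rewrite sub0r normrN => /(le_trans (ler_norm _)).
apply: filterS => k hk j /andP[j0 jk].
set g := gap R k.+1 j.
have g0 : 0 < g by apply: gap_gt0; rewrite j0.
(* For this mu the denominator divided by h^2 is ((1 - w) / h)^2 + mu w, that is, x^2 + mu - mu U
   with the perturbation U defined below. *)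
pose mu := 2 * g / h k ^+ 2.
have mu0 : 0 < mu by rewrite divr_gt0 ?mulr_gt0 ?exprn_gt0.
(* As j >= 1, the lower bound on the gap keeps mu away from 0, so U is small uniformly in j. *)
have mu_inv : mu^-1 <= t ^+ 2.
  rewrite invf_ple ?posrE ?exprn_gt0// /mu /h.
  have kr : 0 < k.+1%:R :> R by [].
  have := @gap_ge R k.+1 j isT jk; rewrite -/g => gg.
  have -> : 2 * g / (t / k.+1%:R) ^+ 2 = (2 * k.+1%:R ^+ 2 * g) * (t ^+ 2)^-1.
    by move: (k.+1%:R : R) kr => r r0; field; rewrite !gt_eqF.
  rewrite ler_peMl ?invr_ge0 ?sqr_ge0//.
  have p0 : 0 < 2 * k.+1%:R ^+ 2 :> R by rewrite mulr_gt0// exprn_gt0.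
  rewrite mulrC -ler_pdivrMr//; apply: le_trans gg.
  by rewrite ler_wpM2r ?invr_ge0 ?(ltW p0)// expr_ge1// ler1n.
pose U s := (x s ^+ 2 - ((1 - w k s) / h k) ^+ 2) / mu + (1 - w k s).
have hU s : `|U s| <= eta.
  apply: le_trans (hk s); apply: le_trans (ler_normD _ _) _; rewrite lerD2r.
  by rewrite normrM ler_wpM2l// gtr0_norm ?invr_gt0.
have half : 2^-1 < 1 :> R by rewrite invf_lt1// ltr1n.
have half0 : 0 <= 2^-1 :> R by rewrite invr_ge0.
have hV := bm_inv_sub1 q1 half0 half
  (bm_le etaC (bmM (bm_small Y q1 hU) (bm_resolvent mu0))).
have := bmZ q1 (2 * g)^-1 (bmM (bm_resolvent mu0) hV).
have -> : `|(2 * g)^-1| * (C * pi ^+ 2 * (1 - 2^-1)^-1) = C1 / g.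
  have g20 : 0 < (2 * g)^-1 by rewrite invr_gt0 mulr_gt0.
  rewrite (gtr0_norm g20) -/C1; have -> : 1 - 2^-1 = 2^-1 :> R by field.
  by field; rewrite gt_eqF.
apply: bm_ext => s; rewrite -/(h k) -/(w k s).
have xm : x s ^+ 2 + mu != 0 by rewrite gt_eqF// ltr_wpDl// sqr_ge0.
have U1 : 1 - U s * (mu / (x s ^+ 2 + mu)) =
    (((1 - w k s) / h k) ^+ 2 + mu * w k s) / (x s ^+ 2 + mu).
  apply: (mulIf xm); rewrite mulrBl mul1r divfK// -mulrA divfK//.
  by rewrite /U; field; rewrite hn0 gt_eqF.
have w0 : 0 < w k s by exact: expR_gt0.
rewrite U1 invf_div [mu / _ * _]mulrCA -[mu / _ * _]mulrA.
have E : ((1 - w k s) / h k) ^+ 2 + mu * w k s =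
    ((1 - w k s) ^+ 2 + 2 * w k s * g) / h k ^+ 2.
  by rewrite /mu; field.
have D0 : (1 - w k s) ^+ 2 + 2 * w k s * g != 0.
  by rewrite gt_eqF// ltr_wpDl ?sqr_ge0// !mulr_gt0.
rewrite E /mu; move: D0; set D := (1 - w k s) ^+ 2 + _ => D0.
have cancel (X d a b : R) : X != 0 -> d != 0 -> a != 0 -> b != 0 ->
    (2 * a)^-1 * (X * (2 * a / b ^+ 2 * (X^-1 / (d / b ^+ 2)))) = d^-1.
  move=> X0 d0 a0 b0; field.
  by rewrite ?X0 ?a0 ?b0 ?d0.
by apply: cancel; rewrite ?D0 ?hn0 ?xm ?(gt_eqF g0).
Qed.

Let A : R := 1 + 2 * C1.

(** For j > 0 the resolvent is 1 - 2 w g / D with D its denominator, whence A. In the second bound 4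
    and 160 come from 2 s and 8 p, where |s| <= 2 gap 1 and |p| <= 20 gap 1 gap (j + 1), and 16 from
    the ratio of gaps. The index 0 is left out because D may vanish there. *)
Lemma bm_resolvent_grid (t : R) : 0 < t -> \forall k \near \oo,
  (forall j, (j <= k.+1)%N ->
    bm A (fun s => resolvent k.+1 (expR (- (t / k.+1%:R * x s))) j)) /\
  (forall j, (0 < j)%N -> (j.+2 <= k.+1)%N ->
    bm (16 * A * C1 * (4 + 160 * C1) * (j.+2%:R ^+ 2)^-1)
      (fun s => let r := resolvent k.+1 (expR (- (t / k.+1%:R * x s))) in
        r j - r j.+1 - (r j.+1 - r j.+2))).
Proof.
move=> t0; have := bm_gap_resolvent t0; apply: filterS => k hk.
pose w s := expR (- (t / k.+1%:R * x s)).
have w0 s : 0 < w s by exact: expR_gt0.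
have bw : bm 1 w by apply: bm_exp; rewrite divr_ge0// ltW.
pose g := gap R k.+1.
have g0 j : (0 < j <= k.+1)%N -> 0 < g j by exact: gap_gt0.
have g_ge0 j : 0 <= g j by exact: gap_ge0.
have g_le2 j : g j <= 2 by rewrite /g /gap lerBlDl -lerBlDr (le_trans _ (cos_geN1 _))//; lra.
pose D j s := (1 - w s) ^+ 2 + 2 * w s * g j.
have D0 j s : (0 < j <= k.+1)%N -> D j s != 0.
  by move=> jk; rewrite gt_eqF// ltr_wpDl ?sqr_ge0// !mulr_gt0// g0.
have hD j : (0 < j <= k.+1)%N -> bm (C1 / g j) (fun s => (D j s)^-1) by exact: hk.
have A1 : 1 <= A by rewrite lerDl mulr_ge0.
have hr j : (j <= k.+1)%N -> bm A (fun s => resolvent k.+1 (w s) j).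
  case: j => [|j] jk; first exact: bm_le A1 (bm1 Y n q).
  have jk' : (0 < j.+1 <= k.+1)%N by [].
  have := bmD q1 (bm1 Y n q) (bmZ q1 (- (2 * g j.+1)) (bmM bw (hD _ jk'))).
  rewrite normrN (ger0_norm (mulr_ge0 _ (g_ge0 _)))//.
  have -> : 1 + 2 * g j.+1 * (1 * (C1 / g j.+1)) = A.
    by rewrite /A; field; rewrite gt_eqF// g0.
  apply: bm_ext => s; rewrite /resolvent -/(g _) -/(D _ _).
  apply: (mulIf (D0 _ s jk')); rewrite divfK ?D0// mulrDl -mulrA -mulrA mulVf ?D0//.
  by rewrite /D; ring.
split=> // j j0 jk.
have jk0 : (0 < j <= k.+1)%N by rewrite j0 (ltnW (ltnW jk)).
have jk1 : (0 < j.+1 <= k.+1)%N by rewrite (ltnW jk).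
have jk2 : (0 < j.+2 <= k.+1)%N by [].
have k10 : (0 < 1 <= k.+1)%N by [].
have Kr : 0 < k.+1%:R :> R by [].
have ratio i : (0 < i <= k.+1)%N -> g 1%N <= 16 / i%:R ^+ 2 * g i.
  move=> /andP[i0 ik]; have ir : 0 < i%:R :> R by rewrite ltr0n.
  apply: le_trans (gap1_le R (ltn0Sn k)) _.
  apply: (le_trans (y := 16 / i%:R ^+ 2 * (i%:R ^+ 2 / (2 * k.+1%:R ^+ 2)))).
    rewrite le_eqVlt; apply/orP; left; apply/eqP.
    by move: (k.+1%:R : R) (i%:R : R) Kr ir => u v u0 v0; field; rewrite !gt_eqF.
  by rewrite ler_wpM2l ?divr_ge0 ?sqr_ge0// gap_ge.
pose s2 := g j.+2 + g j - 2 * g j.+1.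
pose p2 := (g j.+2 - g j.+1) * (g j.+1 - g j).
have s2E : `|s2| <= 2 * g 1%N.
  rewrite /s2 /g gap_second_difference !normrM (ger0_norm (gap_ge0 _ _ _)).
  rewrite ler_wpM2r ?gap_ge0// normr_nat ler_piMr// /gap opprB addrC subrK.
  exact: cos_max.
have p2E : `|p2| <= 20 * (g 1%N * g j.+1).
  rewrite /p2 /g gap_increments normrM (ger0_norm (gap_ge0 _ _ _)) -/(g 1%N) -/(g j.+1).
  rewrite mulrCA ler_wpM2l//; apply: le_trans (ler_normB _ _) _.
  have -> : 20 * g j.+1 = g j.+1 * 4 + 16 * g j.+1 by ring.
  apply: lerD.
    rewrite -mulrA !normrM (ger0_norm (g_ge0 _)) ler_wpM2l//.
    have -> : 4 = 2 * 2 :> R by ring.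
    by apply: ler_pM => //; rewrite ger0_norm ?subr_ge0// lerBlDr lerDl.
  rewrite normrM normrX (ger0_norm (g_ge0 _)).
  apply: (le_trans (y := 1 * g 1%N)).
    rewrite ler_wpM2r// expr_le1// /g /gap opprB addrC subrK.
    exact: cos_max.
  rewrite mul1r; apply: le_trans (ratio _ jk1) _; rewrite ler_wpM2r// ler_pdivrMr ?exprn_gt0//.
  by rewrite ler_peMr// expr_ge1// ler1n.
have h1 := bmZ q1 (- (2 * s2)) (bmM bw (bmM (hr j (ltnW (ltnW jk))) (hD _ jk2))).
have h2 := bmZ q1 (8 * p2) (bmM (bmX 2 bw)
  (bmM (hr j (ltnW (ltnW jk))) (bmM (hD _ jk1) (hD _ jk2)))).
have := bmD q1 h1 h2; rewrite expr1n !mul1r => h.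
have {}h := bm_le _ h.
have hc : `|- (2 * s2)| * (A * (C1 / g j.+2)) +
    `|8 * p2| * (A * (C1 / g j.+1 * (C1 / g j.+2))) <=
    16 * A * C1 * (4 + 160 * C1) * (j.+2%:R ^+ 2)^-1.
  have gj1 := g0 _ jk1; have gj2 := g0 _ jk2.
  have A0 : 0 <= A := le_trans ler01 A1.
  apply: (le_trans (y := (4 * g 1%N) * (A * (C1 / g j.+2)) +
     (160 * (g 1%N * g j.+1)) * (A * (C1 / g j.+1 * (C1 / g j.+2))))).
    have c2 : 0 <= C1 / g j.+2 := divr_ge0 C1_ge0 (ltW gj2).
    have c1 : 0 <= C1 / g j.+1 := divr_ge0 C1_ge0 (ltW gj1).
    apply: lerD.
      apply: ler_wpM2r (mulr_ge0 A0 c2) _ _ _.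
      rewrite normrN normrM normr_nat; apply: le_trans (ler_wpM2l _ s2E) _ => //.
      by rewrite mulrA -natrM.
    apply: ler_wpM2r (mulr_ge0 A0 (mulr_ge0 c1 c2)) _ _ _.
    have -> : 160 * (g 1%N * g j.+1) = 8 * (20 * (g 1%N * g j.+1)) by ring.
    by rewrite normrM normr_nat ler_wpM2l.
  have -> : (4 * g 1%N) * (A * (C1 / g j.+2)) +
     (160 * (g 1%N * g j.+1)) * (A * (C1 / g j.+1 * (C1 / g j.+2))) =
     A * C1 * (4 + 160 * C1) * (g 1%N / g j.+2).
    by field; rewrite !gt_eqF.
  have -> : 16 * A * C1 * (4 + 160 * C1) * (j.+2%:R ^+ 2)^-1 =
     A * C1 * (4 + 160 * C1) * (16 / j.+2%:R ^+ 2) by ring.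
  apply: ler_wpM2l (mulr_ge0 (mulr_ge0 A0 C1_ge0)
    (addr_ge0 (ler0n _ 4) (mulr_ge0 (ler0n _ 160) C1_ge0))) _ _ _.
  by rewrite ler_pdivrMr//; exact: ratio.
apply: bm_ext (h _ hc) => s /=.
have rE i : (0 < i <= k.+1)%N -> resolvent k.+1 (w s) i = (1 - w s) ^+ 2 / D i s.
  by case: i.
rewrite -/(w s) (rE _ jk0) (rE _ jk1) (rE _ jk2).
by rewrite (@resolvent_second_difference _ _ _ _ _ _ s2 p2) ?D0.
Qed.

(** With H = k + 1 and w = exp (- t x / H), the symbol is the limit of H (1 - w) w^H, which equals
    an alternating sum of resolvent differences times (1 + w)(1 - w^(2 H)) / 4. After summation by
    parts the end terms cost 2 A each and the second differences are summable uniformly in H. *)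
Lemma bm_semigroup_derivative (t : R) : 0 < t ->
  bm ((8 * A + 16 * A * C1 * (4 + 160 * C1)) / 2)
    (fun s => t * x s * expR (- (t * x s))).
Proof.
move=> t0; set K0 := 16 * A * C1 * _.
have A0 : 0 <= A := addr_ge0 ler01 (mulr_ge0 (ler0n _ 2) C1_ge0).
have K00 : 0 <= K0.
  exact: mulr_ge0 (mulr_ge0 (mulr_ge0 (ler0n _ 16) A0) C1_ge0)
    (addr_ge0 (ler0n _ 4) (mulr_ge0 (ler0n _ 160) C1_ge0)).
(* The second difference at j = 0 has no decay estimate and is charged 4 A on its own. *)
have first0 (l : nat) : \sum_(i < l) (if i == 0%N :> nat then 4 * A else 0) <= 4 * A.
  case: l => [|l]; first by rewrite big_ord0; exact: mulr_ge0.
  by rewrite big_ord_recl/= big1 ?addr0.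
pose h (k : nat) : R := t / k.+1%:R.
have h0 k : 0 < h k by rewrite divr_gt0.
have hn0 k : h k != 0 by rewrite gt_eqF.
have hc : h k @[k --> \oo] --> 0.
  rewrite -(mulr0 t); apply: cvgM; first exact: cvg_cst.
  exact: (@cvg_harmonic R).
pose w k s := expR (- (h k * x s)).
apply: (@bm_cvg _ (fun k s => k.+1%:R * (1 - w k s) * w k s ^+ k.+1)); last first.
  move=> s; have hx := @cvg_sub1_expR_quotient R (x s) h hn0 hc.
  have -> : (fun k => k.+1%:R * (1 - w k s) * w k s ^+ k.+1) =
      (fun k => t * ((1 - expR (- (h k * x s))) / h k) * expR (- (t * x s))).
    apply/funext => k; rewrite [w k s ^+ _]expR_gridX; congr (_ * _).
    rewrite /w /h invfM invrK; move: (expR _) => e.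
    by rewrite mulrCA mulVKf ?gt_eqF// mulrC.
  by apply: cvgM; [apply: cvgM => //; exact: cvg_cst|exact: cvg_cst].
have := bm_resolvent_grid t0; apply: filterS => k [hr hd].
pose r s := resolvent k.+1 (w k s); pose d s j := r s j - r s j.+1.
have hdd j : (j <= k)%N -> bm (2 * A) (fun s => d s j).
  move=> jk; have := bmD q1 (hr j (leqW jk)) (bmZ q1 (-1) (hr j.+1 jk)).
  rewrite normrN1 mul1r -mulr2n -[A *+ 2]mulr_natl; apply: bm_ext => s.
  by rewrite mulN1r.
have hP : bm ((8 * A + K0) / 2)
    (fun s => \sum_(j < k.+1) (-1) ^+ j * d s j).
  have hS := @bm_sum R Y n q q1 'I_k xpredT
    (fun j => (if j == 0%N :> nat then 4 * A else 0) + K0 * (j.+2%:R ^+ 2)^-1)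
    (fun j s => (-1) ^+ j * (d s j - d s j.+1)).
  have {}hS := bmD q1 (bmD q1 (hdd 0%N isT) (bmZ q1 ((-1) ^+ k) (hdd k (leqnn k)))) (hS _).
  have {}hS : bm (8 * A + K0) (fun s => d s 0%N + (-1) ^+ k * d s k +
      \sum_(j < k) (-1) ^+ j * (d s j - d s j.+1)).
    apply: bm_le (hS _) => [|j _].
      rewrite normrX normrN1 expr1n mul1r big_split/= -mulr_sumr addrA; apply: lerD.
        have -> : 8 * A = 2 * A + 2 * A + 4 * A by ring.
        by rewrite lerD2l first0.
      by rewrite ler_piMr// sum_inv_sqr_le1.
    have sgn : `|(-1) ^+ j| = 1 :> R by rewrite normrX normrN1 expr1n.
    suff hj : bm ((if j == 0%N :> nat then 4 * A else 0) + K0 * (j.+2%:R ^+ 2)^-1)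
        (fun s => d s j - d s j.+1).
      by have := bmZ q1 ((-1) ^+ j) hj; rewrite sgn mul1r.
    case: j {sgn} => -[|j] jk /=.
      have := bmD q1 (hdd 0%N isT) (bmZ q1 (-1) (hdd 1%N jk)).
      move=> h1; apply: bm_le (bm_ext _ h1) => [|s]; last by rewrite mulN1r.
      rewrite normrN1 mul1r.
      have -> : 4 * A = 2 * A + 2 * A by ring.
      by rewrite lerDl mulr_ge0// invr_ge0 sqr_ge0.
    rewrite add0r; exact: hd.
  have := bmZ q1 2^-1 hS; rewrite ger0_norm ?invr_ge0// mulrC.
  apply: bm_ext => s; rewrite -alternating_sum2 mulrA mulVf ?mul1r//.
have bw : bm 1 (w k) by apply: bm_exp; exact: ltW.
have b1 := bmD q1 (bm1 Y n q) bw.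
have b2 := bmD q1 (bm1 Y n q) (bmZ q1 (-1) (bmX (k.+1).*2 bw)).
have := bmZ q1 4^-1 (bmM hP (bmM b1 b2)).
have -> : `|4^-1| * ((8 * A + K0) / 2 * ((1 + 1) * (1 + `|-1| * 1 ^+ (k.+1).*2))) =
    (8 * A + K0) / 2.
  by rewrite normrN1 expr1n ger0_norm ?invr_ge0//; field.
apply: bm_ext => s; rewrite mulN1r /d /r resolvent_alternating_sum ?expR_gt0//.
  by field.
by rewrite -(expR0 R) ler_expR oppr_le0 mulr_ge0// ltW.
Qed.

End AnalyticSemigroup.

(** * The Rademacher projection *)

Lemma cvg_series_cos_coeff (R : realType) (y : R) :
  series (cos_coeff y) @ \oo --> cos y.
Proof. by rewrite cos.unlock; exact: is_cvg_series_cos_coeff. Qed.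

Lemma cvg_series_sin_coeff (R : realType) (y : R) :
  series (sin_coeff y) @ \oo --> sin y.
Proof. by rewrite sin.unlock; exact: is_cvg_series_sin_coeff. Qed.

(** Induction with (1 + 1/j)^j <= e; it trades the j^j of a j-th power of the derivative bound for
    j!. *)
Lemma natX_le_fact (R : realType) (j : nat) :
  j%:R ^+ j <= expR 1 ^+ j * j`!%:R :> R.
Proof.
elim: j => [|j IH]; first by rewrite !expr0 mul1r fact0.
case: j IH => [_|j IH].
  by rewrite !expr1 factS fact0 mul1n mulr1 -(expR0 R) ler_expR.
have jr : 0 < j.+1%:R :> R by [].
have step : j.+2%:R ^+ j.+1 <= expR 1 * j.+1%:R ^+ j.+1 :> R.
  have -> : (j.+2%:R : R) = j.+1%:R * (1 + j.+1%:R^-1).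
    by rewrite mulrDr mulr1 divff ?gt_eqF// natr1.
  rewrite exprMn mulrC ler_wpM2r ?exprn_ge0//.
  have -> : expR 1 = expR (j.+1%:R^-1) ^+ j.+1 :> R.
    by rewrite -expRM_natl divff ?gt_eqF.
  by rewrite lerXn2r ?nnegrE ?addr_ge0 ?invr_ge0 ?expR_ge0// expR_ge1Dx.
rewrite exprS (le_trans (ler_wpM2l _ step))// factS natrM [expR 1 ^+ j.+2]exprS.
rewrite mulrCA -[leRHS]mulrA ler_wpM2l ?expR_ge0//.
by rewrite mulrCA ler_wpM2l.
Qed.

Lemma sum_cos_multiple (R : realType) (M d : nat) : (0 < d < M)%N ->
  \sum_(m < M) cos ((2 * pi / M%:R * d%:R) * m%:R) = 0 :> R.
Proof.
move=> /andP[d0 dM]; have M0 : (0 < M)%N := leq_trans (ltn0Sn d) dM.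
have Mr : 0 < M%:R :> R by rewrite ltr0n.
set psi : R := 2 * pi / M%:R * d%:R.
have s0 : 0 < sin (psi / 2).
  have -> : psi / 2 = pi * (d%:R / M%:R) by rewrite /psi; field; rewrite gt_eqF.
  apply: sin_gt0_pi; rewrite mulr_gt0 ?pi_gt0 ?divr_gt0 ?ltr0n//=.
  by rewrite gtr_pMr ?pi_gt0// ltr_pdivrMr// mul1r ltr_nat.
apply: (mulfI (lt0r_neq0 (mulr_gt0 (ltr0n R 2) s0))); rewrite mulr0 mulr_sumr.
transitivity (\sum_(m < M) (sin (psi * m.+1%:R - psi / 2) - sin (psi * m%:R - psi / 2))).
  apply: eq_bigr => m _.
  have -> : psi * m.+1%:R - psi / 2 = psi * m%:R + psi / 2 by rewrite -natr1; field.
  by rewrite sinD sinB; ring.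
rewrite -(big_mkord xpredT (fun m =>
  sin (psi * m.+1%:R - psi / 2) - sin (psi * m%:R - psi / 2))).
rewrite telescope_sumr// mulr0 sub0r.
have -> : psi * M%:R = pi *+ (2 * d).
  by rewrite /psi -[RHS]mulr_natr natrM; field; rewrite gt_eqF.
have -> : sin (pi *+ (2 * d) - psi / 2) = sin (- (psi / 2)).
  by rewrite sinD cos_pi_mulrn sin_pi_mulrn mul0r add0r exprM sqrrN !expr1n mul1r.
by rewrite subrr.
Qed.

(** The integer k - 1 lies between -1 and n - 1, so it is divisible by n + 2 only when it is 0. *)
Lemma delta1_cos (R : realType) (n k : nat) : (k <= n)%N ->
  (n.+2%:R)^-1 * \sum_(m < n.+2) cos ((2 * pi / n.+2%:R * m%:R) * (k%:R - 1)) =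
  (k == 1%N)%:R :> R.
Proof.
move=> kn; have [->|k1] := eqVneq k 1%N.
  under eq_bigr do rewrite subrr mulr0 cos0.
  by rewrite sumr_const card_ord mulVf.
have [d dM dE] : exists2 d, (0 < d < n.+2)%N &
    forall y : R, cos (y * (k%:R - 1)) = cos (y * d%:R).
  case: k kn k1 => [_ _|[//|k] kn _].
    by exists 1%N => // y; rewrite sub0r mulrN cosN.
  exists k.+1; first exact: leqW (leqW kn).
  by move=> y; rewrite -[k.+2%:R]natr1 addrK.
under eq_bigr do rewrite dE mulrAC.
by rewrite sum_cos_multiple// mulr0.
Qed.

Section RademacherProjection.
Context (R : realType) (Y : normedModType R) (n : nat) (q : R).
Hypothesis q1 : 1 <= q.
Local Notation bm := (@bounded_multiplier R Y n q).
Variables (x : signs n -> R) (C : R).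
Hypothesis C0 : 0 < C.
Hypothesis bm_deriv : forall t : R, 0 < t ->
  bm C (fun s => t * x s * expR (- (t * x s))).
Hypothesis bm_exp : forall t : R, 0 <= t -> bm 1 (fun s => expR (- (t * x s))).

Let sg : R := 16 * C * expR 1.

Let sg0 : 0 < sg.
Proof. by rewrite !mulr_gt0// expR_gt0. Qed.

(** The j-th power of t x exp (- t x) at t = [sg] / j. The choice [sg] = 16 C e turns its bound into
    (j / (16 e))^j <= 16^-j j!. *)
Lemma bm_pow_exp (j : nat) :
  bm ((16^-1) ^+ j * j`!%:R) (fun s => x s ^+ j * expR (- (sg * x s))).
Proof.
case: j => [|j].
  apply: bm_ext (bm_le _ (bm_exp (ltW sg0))) => [s|]; rewrite ?expr0 ?mul1r//.
set J := j.+1; have Jr : 0 < J%:R :> R by [].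
have t0 : 0 < sg / J%:R by rewrite divr_gt0.
have tj : sg / J%:R != 0 by rewrite gt_eqF.
have h := bmZ q1 ((sg / J%:R)^-1 ^+ J) (bmX J (bm_deriv t0)).
apply: bm_ext (bm_le _ h) => [s|].
  by rewrite -exprMn mulrA mulKf// exprMn expR_gridX.
rewrite ger0_norm ?exprn_ge0 ?invr_ge0 ?(ltW t0)// -exprMn.
have -> : (sg / J%:R)^-1 * C = J%:R * (16 * expR 1)^-1.
  by rewrite /sg; field; rewrite !gt_eqF ?expR_gt0.
rewrite exprMn; apply: le_trans (ler_wpM2r _ (natX_le_fact R J)) _.
  by rewrite exprn_ge0// invr_ge0 mulr_ge0 ?expR_ge0.
rewrite mulrAC ler_wpM2r// -exprMn invfM mulrCA divff ?mulr1//.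
Qed.

(** The factorials cancel against [bm_pow_exp], so the k-th term has norm at most (theta / 16)^k <=
    2^-k. The limit 8 covers all angles up to 2 pi. *)
Lemma bm_entire_exp (theta : R) (c : nat -> R) (f : R -> R) :
  0 <= theta <= 8 -> (forall k, `|c k| <= theta ^+ k / k`!%:R) ->
  (forall y, series (fun k => c k * y ^+ k) @ \oo --> f y) ->
  bm 2 (fun s => f (x s) * expR (- (sg * x s))).
Proof.
move=> /andP[t0 t8] hc hf.
apply: (@bm_cvg _ _ _ _ q1 _
  (fun K s => series (fun k => c k * x s ^+ k) K * expR (- (sg * x s)))); last first.
  by move=> s; apply: cvgM; [exact: hf|exact: cvg_cst].
apply: nearW => K.
have h := @bm_sum R Y n q q1 'I_K xpredT _ _ (fun k _ => bmZ q1 (c k) (bm_pow_exp k)).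
apply: bm_ext (bm_le _ h) => [s|].
  by rewrite /series/= big_mkord mulr_suml; apply: eq_bigr => k _; rewrite mulrA.
apply: (le_trans (y := \sum_(k < K) (2^-1) ^+ k)).
  apply: ler_sum => k _; apply: le_trans (ler_wpM2r _ (hc k)) _.
    by rewrite mulr_ge0 ?exprn_ge0 ?invr_ge0.
  have kf : k`!%:R != 0 :> R by rewrite pnatr_eq0 -lt0n fact_gt0.
  have cancel (a b f' : R) : f' != 0 -> a / f' * (b * f') = a * b by move=> ?; field.
  rewrite (cancel _ _ _ kf) -exprMn.
  rewrite lerXn2r ?nnegrE ?mulr_ge0 ?invr_ge0//.
  rewrite -ler_pdivlMr ?invr_gt0// invrK.
  by apply: le_trans t8 _; rewrite -(ler_pM2l (ltr0n R 2)) mulrA divff// mul1r -natrM.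
have h2 : 1 - 2^-1 = 2^-1 :> R by field.
have := sub1_geometric (2^-1 : R) K; rewrite h2 => hS.
have p2 : 0 < 2^-1 :> R by rewrite invr_gt0.
rewrite -(ler_pM2l p2) hS mulVf// lerBlDr lerDl exprn_ge0.
Qed.

(* Discrete Fourier inversion over theta_m = 2 pi m / (n + 2), the numbers
   cos (theta_m (x - 1)) e^(- sg x) being bounded multipliers as Taylor series. *)
Lemma bm_delta1 (k : signs n -> nat) : (forall s, (k s <= n)%N) ->
  (forall s, x s = (k s)%:R) -> bm (4 * expR sg) (fun s => (k s == 1%N)%:R).
Proof.
move=> kn xk; pose th (m : nat) : R := 2 * pi / n.+2%:R * m%:R.
have th08 (m : 'I_n.+2) : 0 <= th m <= 8.
  apply/andP; split; first by rewrite !mulr_ge0 ?pi_ge0 ?invr_ge0.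
  apply: (le_trans (y := 2 * pi)).
    rewrite /th -mulrA ler_piMr ?mulr_ge0 ?pi_ge0// mulrC ler_pdivrMr// mul1r ler_nat.
    exact: ltnW.
  have -> : 8 = 2 * (2 * 2) :> R by ring.
  by rewrite ler_wpM2l// -ler_pdivrMr// ltW// pihalf_lt2.
have coef (c : R -> nat -> R) : (forall y j, c y j = c 1 j * y ^+ j) ->
    (forall j, `|c 1 j| <= (j`!%:R)^-1) -> forall (m : 'I_n.+2) j,
    `|c 1 j * th m ^+ j| <= th m ^+ j / j`!%:R.
  move=> _ h m j; case/andP: (th08 m) => t0 _.
  by rewrite normrM normrX (ger0_norm t0) mulrC ler_wpM2l ?exprn_ge0.
have hcos (m : 'I_n.+2) : bm 2 (fun s => cos (th m * x s) * expR (- (sg * x s))).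
  apply: (@bm_entire_exp (th m) (fun j => cos_coeff 1 j * th m ^+ j)
    (fun y => cos (th m * y)) (th08 m)).
    apply: (coef (@cos_coeff R)) => [y j|j].
      by rewrite /cos_coeff/= -?exprnP expr1n; ring.
    rewrite /cos_coeff/= -?exprnP expr1n mulr1 normrM normfV normr_nat ler_piMl ?invr_ge0//.
    rewrite normrM normrX normrN1 expr1n mulr1.
    by case: odd; rewrite ?normr0 ?normr1.
  move=> y; have -> : (fun j => cos_coeff 1 j * th m ^+ j * y ^+ j) = cos_coeff (th m * y).
    by apply/funext => j; rewrite /cos_coeff/= -?exprnP expr1n (exprMn _ (th m) y);
      move: (th m ^+ j) (y ^+ j) => a b; ring.
  exact: cvg_series_cos_coeff.
have hsin (m : 'I_n.+2) : bm 2 (fun s => sin (th m * x s) * expR (- (sg * x s))).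
  apply: (@bm_entire_exp (th m) (fun j => sin_coeff 1 j * th m ^+ j)
    (fun y => sin (th m * y)) (th08 m)).
    apply: (coef (@sin_coeff R)) => [y j|j].
      by rewrite /sin_coeff/= expr1n; ring.
    rewrite /sin_coeff/= expr1n mulr1 normrM normfV normr_nat ler_piMl ?invr_ge0//.
    rewrite normrM normrX normrN1 expr1n mulr1.
    by case: odd; rewrite ?normr0 ?normr1.
  move=> y; have -> : (fun j => sin_coeff 1 j * th m ^+ j * y ^+ j) = sin_coeff (th m * y).
    by apply/funext => j; rewrite /sin_coeff/= expr1n (exprMn _ (th m) y);
      move: (th m ^+ j) (y ^+ j) => a b; ring.
  exact: cvg_series_sin_coeff.
have h := bmZ q1 (expR sg / n.+2%:R) (@bm_sum R Y n q q1 'I_n.+2 xpredT _ _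
  (fun m _ => bmD q1 (bmZ q1 (cos (th m)) (hcos m)) (bmZ q1 (sin (th m)) (hsin m)))).
apply: bm_ext (bm_le _ h) => [s|].
  (* At the only surviving level x = 1 the factor exp [sg] undoes the damping. *)
  transitivity (expR sg * expR (- (sg * x s)) *
      (n.+2%:R^-1 * \sum_(m < n.+2) cos (th m * (x s - 1)))).
    set E := expR (- _); set S := \sum_(m < _) cos _.
    have -> : \sum_(m < n.+2) (cos (th m) * (cos (th m * x s) * E) +
        sin (th m) * (sin (th m * x s) * E)) = E * S.
      rewrite mulr_sumr; apply: eq_bigr => m _.
      by rewrite mulrBr mulr1 cosB; ring.
    by move: E S (expR sg) => E S e; ring.
  rewrite xk delta1_cos//; have [->|] := eqVneq (k s) 1%N; last by rewrite mulr0.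
  by rewrite !mulr1 -expRD subrr expR0.
rewrite ger0_norm ?divr_ge0 ?expR_ge0//.
apply: (le_trans (y := expR sg / n.+2%:R * \sum_(m < n.+2) 4)).
  rewrite ler_wpM2l ?divr_ge0 ?expR_ge0//; apply: ler_sum => m _.
  have -> : 4 = 1 * 2 + 1 * 2 :> R by ring.
  by rewrite lerD// ler_wpM2r// ?cos_max ?sin_max.
have -> : \sum_(m < n.+2) 4 = n.+2%:R * 4 :> R by rewrite sumr_const card_ord mulr_natl.
by rewrite mulrA divfK// mulrC.
Qed.

End RademacherProjection.

Section KConvexity.
Context (R : realType) (Y : normedModType R) (q : R).
Hypothesis q2 : 2 <= q.
Hypothesis type_Y : nontrivial_type Y.

Let q1 : 1 <= q.
Proof. by apply: le_trans q2; rewrite ler1n. Qed.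

(** K-convexity of Y: the constant is fixed before the dimension n. *)
Lemma bm_weight1 : exists2 K : R, 0 < K & forall n,
  bounded_multiplier Y q K (fun s : signs n => (weight s == 1%N)%:R).
Proof.
have [C C0 hC] := bm_inv_add1_exp_weight type_Y q2.
pose C1 := C * pi ^+ 2; pose A := 1 + 2 * C1.
pose C2 := (8 * A + 16 * A * C1 * (4 + 160 * C1)) / 2.
have C10 : 0 < C1 by rewrite mulr_gt0// exprn_gt0// pi_gt0.
have A0 : 0 < A by rewrite addr_gt0// mulr_gt0.
have C20 : 0 < C2.
  exact: divr_gt0 (addr_gt0 (mulr_gt0 (ltr0Sn R 7) A0)
    (mulr_gt0 (mulr_gt0 (mulr_gt0 (ltr0Sn R 15) A0) C10)
      (addr_gt0 (ltr0Sn R 3) (mulr_gt0 (ltr0Sn R 159) C10)))) (ltr0Sn R 1).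
exists (4 * expR (16 * C2 * expR 1)); first by rewrite mulr_gt0 ?expR_gt0.
move=> n; pose x (s : signs n) : R := (weight s)%:R.
have x0 s : 0 <= x s by exact: ler0n.
have ex (t : R) (s : signs n) : expR (- t) ^+ weight s = expR (- (t * x s)).
  by rewrite -expRM_natl mulrN mulrC.
have z01 (t : R) : 0 <= t -> 0 <= expR (- t) <= 1.
  by move=> t0; rewrite expR_ge0 -(expR0 R) ler_expR oppr_le0.
have bexp (t : R) : 0 <= t -> bounded_multiplier Y q 1 (fun s => expR (- (t * x s))).
  by move=> t0; apply: bm_ext (bm_exp_weight Y q1 n (z01 _ t0)) => s; rewrite ex.
have bfermi (t : R) : 0 <= t ->
    bounded_multiplier Y q C (fun s => (1 + expR (- (t * x s)))^-1).
  by move=> t0; apply: bm_ext (hC n _ (z01 _ t0)) => s; rewrite ex.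
have bder (t : R) : 0 < t ->
    bounded_multiplier Y q C2 (fun s => t * x s * expR (- (t * x s))).
  by move=> t0; exact: (bm_semigroup_derivative q1 x0 bexp bfermi t0).
have wn (s : signs n) : (weight s <= n)%N.
  rewrite /weight -[leqRHS](card_ord n) -sum1_card; apply: leq_sum => i _.
  exact: leq_b1.
exact: (bm_delta1 q1 C20 bder bexp wn (fun=> erefl)).
Qed.

Lemma sum_weight1 n (V : lmodType R) (F : signs n -> V) :
  \sum_s (weight s == 1%N)%:R *: F s = \sum_(j < n) F [ffun i => i == j].
Proof.
pose d (j : 'I_n) : signs n := [ffun i => i == j].
have dw j : weight (d j) = 1%N.
  rewrite /weight (bigD1 j)//= ffunE eqxx big1// => i /negbTE ij.
  by rewrite ffunE ij.
have e s : (weight s == 1%N)%:R = \sum_j (s == d j)%:R :> R.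
  have [w1|w1] := eqVneq (weight s) 1%N; last first.
    by rewrite big1// => j _; case: (eqVneq s (d j)) w1 => [->|]; rewrite ?dw.
  have [j sj] : exists j, s j.
    apply/existsP; apply: contraT; rewrite negb_exists => /forallP h.
    by move: w1; rewrite /weight big1// => i _; rewrite (negbTE (h i)).
  have sd : s = d j.
    apply/ffunP => i; rewrite ffunE; have [->|ij] := eqVneq i j; first exact: sj.
    apply/negbTE/negP => si; move: w1.
    by rewrite /weight (bigD1 j)//= (bigD1 i)//= sj si.
  rewrite (bigD1 j)//= sd eqxx big1 ?addr0// => i ij.
  case: eqVneq => // /ffunP /(_ j); rewrite !ffunE eqxx => /esym/eqP ji.
  by rewrite ji eqxx in ij.
under eq_bigr do rewrite e scaler_suml.
rewrite exchange_big/=; apply: eq_bigr => j _.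
rewrite (bigD1 (d j))//= eqxx scale1r big1 ?addr0// => s /negbTE ->.
by rewrite scale0r.
Qed.

Definition rademacher_coef n (g : signs n -> Y) (j : 'I_n) : Y :=
  (2 ^+ n)^-1 *: \sum_(w : signs n) (-1) ^+ w j *: g w.

(** Cotype applied to the coefficients compares them with the projection of g onto level 1, which
    K-convexity bounds by g. *)
Lemma rademacher_cotype : has_cotype Y q -> exists2 K : R, 0 < K &
  forall n (g : signs n -> Y),
  \sum_(j < n) `|rademacher_coef g j| `^ q <= K * ((2 ^+ n)^-1 * \sum_w `|g w| `^ q).
Proof.
move=> [C C0 hC]; have [K K0 hK] := bm_weight1.
exists (C^-1 * K `^ q); first by rewrite mulr_gt0 ?invr_gt0 ?powR_gt0.
move=> n g; have n2 : 0 < 2 ^+ n :> R by rewrite exprn_gt0.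
have E : multiplier (fun s : signs n => (weight s == 1%N)%:R) g =
    (fun w => \sum_(j < n) (-1) ^+ w j *: rademacher_coef g j).
  apply/funext => w; rewrite /multiplier.
  under eq_bigr do rewrite -scalerA.
  rewrite sum_weight1 scaler_sumr; apply: eq_bigr => j _.
  have wj v : walsh R [ffun i => i == j] v = (-1) ^+ v j.
    rewrite /walsh (bigD1 j)//= ffunE eqxx big1 ?mulr1// => i /negbTE ij.
    by rewrite ffunE ij.
  rewrite wj /rademacher_coef scalerA mulrC -scalerA; congr (_ *: (_ *: _)).
  by apply: eq_bigr => v _; rewrite wj.
have := le_lqX q1 (bm_lq (hK n) g); rewrite E powRM ?(ltW K0) ?lq_ge0// lqX// => h.
rewrite -mulrA -ler_pdivrMl ?invr_gt0// invrK.
apply: le_trans (hC n (rademacher_coef g)) _.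
rewrite /sign_average mulrCA ler_wpM2l ?invr_ge0 ?(ltW n2)//.
Qed.

End KConvexity.

(** * Metric cotype *)

Lemma powR_avg_le (R : realType) (q : R) (T : finType) (a : T -> R) :
  1 <= q -> (forall i, 0 <= a i) -> (0 < #|T|)%N ->
  ((\sum_i a i) / #|T|%:R) `^ q <= (\sum_i a i `^ q) / #|T|%:R.
Proof.
move=> q1 a0 T0; have := powR_sum_le q1 (fun i => a0 (enum_val i)) T0.
have sumE (f : T -> R) : \sum_t f t = \sum_(i < #|T|) f (enum_val i).
  exact: (reindex _ (onW_bij _ (enum_val_bij T))).
by rewrite -(sumE a) -(sumE (fun i => a i `^ q)).
Qed.

Section MetricCotype.
Context (R : realType) (Y : normedModType R) (q K : R).
Hypotheses (q1 : 1 <= q) (K0 : 0 < K).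
Hypothesis hK : forall n (g : signs n -> Y),
  \sum_(j < n) `|rademacher_coef g j| `^ q <= K * ((2 ^+ n)^-1 * \sum_w `|g w| `^ q).

Let q0 : 0 < q := lt_le_trans ltr01 q1.

Context (G : finZmodType) (n : nat) (a : 'I_n -> G) (g : G -> Y).

Definition signed_step (e : signs n) : G := \sum_j (if e j then - a j else a j).

Definition edge_energy : R :=
  (2 ^+ n)^-1 * \sum_(e : signs n) \sum_x `|g (x + signed_step e) - g x| `^ q.

(** The weight is 2 or 0: this is the mean of g over the signed steps whose j-th sign is +. *)
Definition smoothing (j : 'I_n) (x : G) : Y :=
  (2 ^+ n)^-1 *: \sum_(e : signs n) (1 + (-1) ^+ e j) *: g (x + signed_step e).

Definition smoothed_derivative (j : 'I_n) (x : G) : Y :=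
  rademacher_coef (fun e => g (x + signed_step e) - g x) j.

Let n2 : 0 < 2 ^+ n :> R.
Proof. by rewrite exprn_gt0. Qed.

Let card_signs : #|{: signs n}|%:R = 2 ^+ n :> R.
Proof. by rewrite card_ffun card_bool card_ord natrX. Qed.

Lemma signed_step_flip j (e : signs n) :
  signed_step (flip [ffun i => i == j] e) =
  signed_step e + (if e j then a j *+ 2 else - (a j *+ 2)).
Proof.
rewrite /signed_step (bigD1 j)//= [in RHS](bigD1 j)//= !ffunE eqxx addTb.
rewrite [in RHS]addrAC; congr (_ + _).
  by case: (e j) => /=; rewrite mulr2n ?addKr// opprD addrA subrr add0r.
by apply: eq_bigr => i /negbTE ij; rewrite !ffunE ij addFb.
Qed.

Lemma sum_sign j : \sum_(e : signs n) (-1) ^+ e j = 0 :> R.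
Proof.
have inj : injective (@flip n [ffun i => i == j]) by exact: flip_inj.
have h : \sum_(e : signs n) (-1) ^+ e j = - \sum_(e : signs n) (-1) ^+ e j :> R.
  rewrite {1}(reindex_inj inj) -sumrN; apply: eq_bigr => e _.
  by rewrite !ffunE eqxx addTb; case: (e j); rewrite ?opprK.
by apply/eqP; rewrite -[_ == 0](mulrn_eq0 _ 2) mulr2n {2}h subrr.
Qed.

(* Conditioning on the j-th sign: the average over e_j = -1 at x is the average
   over e_j = +1 at x - 2 a_j. *)
Lemma smoothing_shift j x :
  smoothing j (x + a j *+ 2) - smoothing j x = 2 *: smoothed_derivative j (x + a j *+ 2).
Proof.
have -> : smoothing j x = (2 ^+ n)^-1 *:
    \sum_(e : signs n) (1 - (-1) ^+ e j) *: g (x + a j *+ 2 + signed_step e).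
  have inj : injective (@flip n [ffun i => i == j]) by exact: flip_inj.
  rewrite /smoothing (reindex_inj inj); congr (_ *: _); apply: eq_bigr => e _.
  rewrite signed_step_flip !ffunE eqxx addTb; case: (e j) => /=.
    by rewrite expr0 expr1 opprK addrAC addrA.
  by rewrite expr1 expr0 !subrr !scale0r.
rewrite /smoothing /smoothed_derivative /rademacher_coef -scalerBr scalerA mulrC -scalerA.
rewrite -sumrB; congr (_ *: _).
under [in RHS]eq_bigr do rewrite scalerBr.
rewrite [in RHS]sumrB -[X in _ = 2 *: (_ - X)]scaler_suml sum_sign scale0r subr0 scaler_sumr.
apply: eq_bigr => e _; rewrite -scalerBl scalerA; congr (_ *: _).
by ring.
Qed.

Lemma smoothing_shiftn j l x :
  smoothing j (x + a j *+ (2 * l)) - smoothing j x =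
  \sum_(i < l) 2 *: smoothed_derivative j (x + a j *+ (2 * i.+1)).
Proof.
elim: l => [|l IH]; first by rewrite muln0 mulr0n addr0 subrr big_ord0.
rewrite big_ord_recr/= -IH mulnS addnC mulrnDr addrA -smoothing_shift.
by rewrite [RHS]addrC [RHS]addrA subrK.
Qed.

Let D : R := edge_energy `^ q^-1.

Let edge_energy_ge0 : 0 <= edge_energy.
Proof.
rewrite mulr_ge0 ?invr_ge0 ?(ltW n2)// sumr_ge0// => e _; exact: sumr_ge0.
Qed.

Let DX : D `^ q = edge_energy.
Proof. by rewrite /D -powRrM mulVf ?gt_eqF// powRr1. Qed.

Lemma lq_smoothing_sub j : lq q (fun x => smoothing j x - g x) <= 2 * D.
Proof.
have E : (fun x => smoothing j x - g x) = (fun x =>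
    \sum_(e : signs n) ((2 ^+ n)^-1 * (1 + (-1) ^+ e j)) *: (g (x + signed_step e) - g x)).
  apply/funext => x; under eq_bigr do rewrite -scalerA scalerBr scalerBr.
  rewrite sumrB -!scaler_sumr; congr (_ - _).
  rewrite -scaler_suml big_split/= sum_sign addr0 sumr_const scalerA.
  by rewrite -[1 *+ _]/(_%:R) card_signs mulVf ?gt_eqF// scale1r.
rewrite E; apply: le_trans (lq_sum q1 _ _) _.
pose b (e : signs n) := lq q (fun x => g (x + signed_step e) - g x).
apply: (le_trans (y := \sum_(e : signs n) (2 ^+ n)^-1 * 2 * b e)).
  apply: ler_sum => e _; rewrite (lqZ q1) ler_wpM2r ?lq_ge0//.
  rewrite normrM ger0_norm ?invr_ge0 ?(ltW n2)// ler_wpM2l ?invr_ge0 ?(ltW n2)//.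
  by case: (e j); rewrite ?expr0 ?expr1 ?subrr ?normr0// ger0_norm.
rewrite -mulr_sumr mulrAC mulrC ler_wpM2l//.
have b0 e : 0 <= b e by exact: lq_ge0.
have cs : (0 < #|{: signs n}|)%N by apply/card_gt0P; exists [ffun=> false].
have := powR_avg_le q1 b0 cs; rewrite card_signs.
have -> : (\sum_e b e `^ q) / 2 ^+ n = D `^ q.
  by rewrite DX mulrC; congr (_ * _); apply: eq_bigr => e _; exact: lqX.
rewrite mulrC => h; rewrite leNgt; apply/negP => lt.
have S0 : 0 <= (2 ^+ n)^-1 * \sum_e b e by rewrite mulr_ge0 ?invr_ge0 ?(ltW n2) ?sumr_ge0.
by have := gt0_ltr_powR q0 (powR_ge0 _ _) S0 lt; rewrite ltNge h.
Qed.

(** [hK] at each x bounds the sum over all directions by K times the edge energy, so some direction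
    in J receives at most a share 1 / |J|. *)
Lemma exists_smoothed_derivative (J : {set 'I_n}) : (0 < #|J|)%N ->
  exists2 j, j \in J & lq q (smoothed_derivative j) <= (K / #|J|%:R) `^ q^-1 * D.
Proof.
move=> J0; have /card_gt0P[j0 j0J] := J0.
have Jr : 0 < #|J|%:R :> R by rewrite ltr0n.
have hsum : \sum_(j < n) \sum_x `|smoothed_derivative j x| `^ q <= K * edge_energy.
  rewrite exchange_big/=.
  apply: le_trans (ler_sum _ (fun x _ => hK (fun e => g (x + signed_step e) - g x))) _.
  by rewrite -mulr_sumr -mulr_sumr exchange_big.
have [j jJ hj] : exists2 j, j \in J &
    \sum_x `|smoothed_derivative j x| `^ q <= K / #|J|%:R * edge_energy.
  apply: (@sum_le_exists _ _ (mem J) j0 _ (fun=> K / #|J|%:R * edge_energy)) => //.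
  rewrite sumr_const -[leRHS]mulr_natr mulrAC divfK ?gt_eqF//.
  apply: le_trans hsum; rewrite [leRHS](bigID (mem J))/= lerDl sumr_ge0// => i _.
  exact: sumr_ge0.
exists j => //; apply: lq_le => //; first by rewrite mulr_ge0 ?powR_ge0.
rewrite powRM ?powR_ge0// DX -powRrM mulVf ?gt_eqF// powRr1//.
by rewrite divr_ge0// ltW.
Qed.

(** Passing from g to its smoothing costs 2 edge norms at each end. In between lie l increments of
    the smoothing along 2 a_j, each twice a smoothed derivative, and only these gain from the choice
    of j. *)
Lemma metric_cotype (J : {set 'I_n}) (l : nat) : (0 < #|J|)%N ->
  exists2 j, j \in J & lq q (fun x => g (x + a j *+ (2 * l)) - g x) <=
    (4 + 2 * l%:R * (K / #|J|%:R) `^ q^-1) * edge_energy `^ q^-1.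
Proof.
move=> J0; have [j jJ hj] := exists_smoothed_derivative J0; exists j => //.
have inj k : injective (fun x : G => x + a j *+ k) by exact: addIr.
have E : (fun x => g (x + a j *+ (2 * l)) - g x) = (fun x =>
    - (smoothing j (x + a j *+ (2 * l)) - g (x + a j *+ (2 * l))) +
    ((smoothing j x - g x) +
      \sum_(i < l) 2 *: smoothed_derivative j (x + a j *+ (2 * i.+1)))).
  apply/funext => x; rewrite -smoothing_shiftn opprB.
  by rewrite [X in _ = _ + X]addrC !subrKA.
rewrite E; apply: le_trans (lqD q1 _ _) _.
rewrite lqN (lq_reindex q (fun x => smoothing j x - g x) (inj _)).
apply: le_trans (lerD (lq_smoothing_sub j) (lqD q1 _ _)) _.
apply: le_trans (lerD (lexx _) (lerD (lq_smoothing_sub j) (lq_sum q1 _ _))) _.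
have -> : (4 + 2 * l%:R * (K / #|J|%:R) `^ q^-1) * edge_energy `^ q^-1 =
  2 * D + (2 * D + l%:R * (2 * ((K / #|J|%:R) `^ q^-1 * D))) by rewrite -/D; ring.
have <- : \sum_(i < l) 2 * ((K / #|J|%:R) `^ q^-1 * D) =
  l%:R * (2 * ((K / #|J|%:R) `^ q^-1 * D)) by rewrite sumr_const card_ord -[LHS]mulr_natl.
rewrite !lerD2l.
apply: ler_sum => i _.
rewrite (lqZ q1 2 (fun x => smoothed_derivative j (x + a j *+ (2 * i.+1)))).
rewrite (lq_reindex q (smoothed_derivative j) (inj _)) normr_nat.
exact: ler_wpM2l (ler0n _ 2) _ _ hj.
Qed.

End MetricCotype.

(** * Zigzag embeddings *)

(** A segment from x to z splits into steps of length at most 1, each controlled by the modulus at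
    1. *)
Lemma coarse_lipschitz (R : realType) (X Y : normedModType R) (f : X -> Y) :
  coarse f -> exists2 A : R, 0 < A &
    forall x z, `|f x - f z| <= A * (`|x - z| + 1).
Proof.
move=> /(_ 1 ler01); rewrite /expansion_modulus; set S := [set d | _] => hS.
have Sub x z : `|x - z| <= 1 -> (`|f x - f z|%:E <= ereal_sup S)%E.
  by move=> xz; apply: ereal_sup_ubound; exists x, z.
have [A0 A0E] : exists A0 : R, ereal_sup S = A0%:E.
  have := Sub 0 0; rewrite subrr normr0 => /(_ ler01); rewrite subrr normr0.
  by case: (ereal_sup S) hS => [r _ _|//|//]; exists r.
have {}Sub x z : `|x - z| <= 1 -> `|f x - f z| <= A0.
  by move=> /Sub; rewrite A0E lee_fin.
have A00 : 0 <= A0.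
  by have := Sub 0 0; rewrite !subrr !normr0; apply.
exists (A0 + 1); first by rewrite ltr_wpDl.
have step k : forall x z, `|x - z| <= k%:R -> `|f x - f z| <= (A0 + 1) * k%:R.
  elim: k => [|k IH] x z.
    rewrite normr_le0 subr_eq0 => /eqP ->.
    by rewrite subrr normr0 mulr0.
  move=> xz; pose w := z + (k%:R / k.+1%:R) *: (x - z).
  have kr : 0 < k.+1%:R :> R by [].
  have wz : `|w - z| <= k%:R.
    rewrite /w addrAC subrr add0r normrZ ger0_norm ?divr_ge0//.
    apply: le_trans (ler_wpM2l _ xz) _; first by rewrite divr_ge0.
    by rewrite divfK// gt_eqF.
  have xw : `|x - w| <= 1.
    have -> : x - w = (k.+1%:R)^-1 *: (x - z).
      rewrite /w opprD addrA -{1}[x - z]scale1r -scalerBl; congr (_ *: _).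
      have kn : k.+1%:R != 0 :> R by rewrite gt_eqF.
      apply: (mulIf kn); rewrite mulrBl mul1r divfK// mulVf//.
      by rewrite -natr1 addrAC subrr add0r.
    by rewrite normrZ ger0_norm ?invr_ge0// mulrC ler_pdivrMr// mul1r.
  rewrite -[f x](subrK (f w)) -addrA; apply: le_trans (ler_normD _ _) _.
  have -> : (A0 + 1) * k.+1%:R = (A0 + 1) + (A0 + 1) * k%:R.
    by rewrite -[k.+1%:R]natr1 mulrDr mulr1 addrC.
  apply: lerD (IH _ _ wz).
  by apply: le_trans (Sub _ _ xw) _; rewrite lerDl.
move=> x z; pose k := (Num.truncn `|x - z|).+1.
have xzk : `|x - z| <= k%:R by rewrite ltW// truncnS_gt.
apply: le_trans (step _ _ _ xzk) _; rewrite ler_wpM2l ?addr_ge0//.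
rewrite /k -[_.+1%:R]natr1 lerD2r.
by have /andP[] := truncn_itv (normr_ge0 (x - z)).
Qed.

Section Zigzag.
Variable l : nat.
Hypothesis l0 : (0 < l)%N.

(* A triangular wave of period 4 l, slope 1 and range [-l, l]. *)
Definition zigzag (k : nat) : int :=
  if (k %% (4 * l) <= 2 * l)%N then l%:Z - (k %% (4 * l))%N%:Z
  else (k %% (4 * l))%N%:Z - (3 * l)%N%:Z.

Lemma zigzag_mod k : zigzag (k %% (4 * l)) = zigzag k.
Proof. by rewrite /zigzag modn_mod. Qed.

Lemma modn_add_cases (r c m : nat) : (r < m)%N -> (c <= m)%N ->
  ((r + c) %% m)%N = if (r + c < m)%N then (r + c)%N else (r + c - m)%N.
Proof.
move=> rm cm; case: ltnP => h; first by rewrite modn_small.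
rewrite -{1}(subnK h) modnDr modn_small//; lia.
Qed.

Let modl k : (k %% (4 * l) < 4 * l)%N.
Proof. by rewrite ltn_mod; lia. Qed.

Lemma zigzag_add k c : (c <= 4 * l)%N ->
  zigzag (k + c) = zigzag (if (k %% (4 * l) + c < 4 * l)%N
    then k %% (4 * l) + c else k %% (4 * l) + c - 4 * l)%N.
Proof.
move=> h; rewrite -(modn_add_cases (modl k) h) zigzag_mod -zigzag_mod.
by rewrite -[RHS]zigzag_mod modnDml.
Qed.

Lemma zigzag_small k : (k < 4 * l)%N ->
  zigzag k = if (k <= 2 * l)%N then l%:Z - k%:Z else k%:Z - (3 * l)%N%:Z.
Proof. by move=> h; rewrite /zigzag modn_small. Qed.

Lemma zigzag_step k : exists b : bool, zigzag k.+1 - zigzag k = (-1) ^+ b.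
Proof.
have hr := modl k; rewrite -(zigzag_mod k) -addn1 zigzag_add; last by lia.
exists ((k %% (4 * l) < 2 * l)%N); set r := (k %% _)%N in hr *.
case: ifP => h; rewrite !zigzag_small; try lia;
  case: ltnP => h2; rewrite ?expr0 ?expr1; do ?case: ifP; lia.
Qed.

Lemma zigzag_half k : zigzag (k + 2 * l) = - zigzag k.
Proof.
have hr := modl k; rewrite -(zigzag_mod k) zigzag_add; last by lia.
set r := (k %% _)%N in hr *.
by case: ifP => h; rewrite !zigzag_small; try lia; do ?case: ifP; lia.
Qed.

(** Of two points a quarter period apart, one has height at least l / 2 in absolute value, and a
    half turn from there moves the wave by at least l. *)
Lemma zigzag_quarter k : `|zigzag k| + `|zigzag (k + l)| = l%:Z.
Proof.
have hr := modl k; rewrite -(zigzag_mod k) zigzag_add; last by lia.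
set r := (k %% _)%N in hr *.
by case: ifP => h; rewrite !zigzag_small; try lia; do ?case: ifP; lia.
Qed.

End Zigzag.

Section ZigzagEmbedding.
Context (R : realType) (X : normedModType R) (q : R).
Hypothesis q1 : 1 <= q.
Variables (l M n : nat) (v : 'I_n -> X).
Hypothesis ME : M.+1 = (4 * l)%N.

Let q0 : 0 < q := lt_le_trans ltr01 q1.
Let l0 : (0 < l)%N. Proof. by lia. Qed.

Local Notation torus := 'rV['I_M.+1]_n.

Definition torus_basis (j : 'I_n) : torus := \row_i (if i == j then inZp 1 else 0).

Definition wave (k : torus) i : int := zigzag l (k 0 i).

Definition zigzag_map (k : torus) : X := \sum_i (wave k i)%:~R *: v i.

Lemma mulrn_row (k : torus) c i : (k *+ c) 0 i = k 0 i *+ c.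
Proof. by elim: c => [|c IH]; rewrite ?mulr0n ?mxE// !mulrS mxE IH. Qed.

Lemma inZp_mulrn c : (inZp 1 : 'I_M.+1) *+ c = inZp c.
Proof. by apply: val_inj; rewrite Zp_mulrn /= modnMml mul1n. Qed.

Lemma torus_basis_mulrn j c i :
  (torus_basis j *+ c) 0 i = if i == j then inZp c else 0.
Proof.
by rewrite mulrn_row mxE; case: eqP => _; rewrite ?inZp_mulrn ?mul0rn.
Qed.

Lemma zigzag_Zp_add (u : 'I_M.+1) c :
  zigzag l ((u + inZp c)%R : 'I_M.+1) = zigzag l (u + c).
Proof.
have zm k : zigzag l (k %% M.+1) = zigzag l k by rewrite ME zigzag_mod.
by rewrite -[RHS]zm /= modnDmr.
Qed.

Lemma signed_step_coord (e : signs n) i :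
  signed_step torus_basis e 0 i = if e i then - inZp 1 else inZp 1.
Proof.
rewrite /signed_step summxE (bigD1 i)//= big1 ?addr0.
  by case: (e i); rewrite ?mxE eqxx.
move=> j /negbTE ji; rewrite eq_sym in ji.
by case: (e j); rewrite !mxE ji ?oppr0.
Qed.

Lemma zigzag_signed_step (k : torus) e i : exists b : bool,
  wave (k + signed_step torus_basis e) i - wave k i = (-1) ^+ b.
Proof.
rewrite /wave mxE signed_step_coord; case: (e i); last first.
  by rewrite zigzag_Zp_add addn1; exact: zigzag_step.
set u := k 0 i; have [b hb] := zigzag_step l0 ((u - inZp 1)%R : 'I_M.+1).
exists (~~ b); rewrite -addn1 -zigzag_Zp_add subrK in hb.
by rewrite -opprB hb; case: b {hb}.
Qed.

Definition half_turn (d : signs n) : torus := \row_i (if d i then inZp (2 * l) else 0).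

Lemma zigzag_half_turn (k : torus) d i :
  wave (k + half_turn d) i = (-1) ^+ d i * wave k i.
Proof.
rewrite /wave !mxE; case: (d i); last by rewrite addr0 expr0 mul1r.
by rewrite zigzag_Zp_add zigzag_half// expr1 mulN1r.
Qed.

(** An increment along a signed step is a sum of the vectors ± v_i whose signs depend on k. Half
    turns permute the torus and multiply these signs by any prescribed pattern, so averaging over
    half turns makes all patterns equally likely. *)
Lemma sum_zigzag_map_step (e : signs n) :
  \sum_(k : torus) `|zigzag_map (k + signed_step torus_basis e) - zigzag_map k| `^ q =
  #|{: torus}|%:R * sign_average q v.
Proof.
pose d (k : torus) i := wave (k + signed_step torus_basis e) i - wave k i.
have hd k : zigzag_map (k + signed_step torus_basis e) - zigzag_map k =
    \sum_i (d k i)%:~R *: v i.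
  by rewrite -sumrB; apply: eq_bigr => i _; rewrite -scalerBl -intrB.
have hdd (h : signs n) k i : d (k + half_turn h) i = (-1) ^+ h i * d k i.
  by rewrite /d addrAC !zigzag_half_turn mulrBr.
have shift (h : signs n) : \sum_(k : torus) `|\sum_i (d k i)%:~R *: v i| `^ q =
    \sum_(k : torus) `|\sum_i ((-1) ^+ h i * d k i)%:~R *: v i| `^ q.
  rewrite (reindex_inj (addIr (half_turn h))); apply: eq_bigr => k _.
  by congr (`|_| `^ q); apply: eq_bigr => i _; rewrite hdd.
under eq_bigr do rewrite hd.
have n2 : 2 ^+ n != 0 :> R by rewrite expf_neq0.
apply: (mulfI n2).
transitivity (\sum_(h : signs n) \sum_(k : torus) `|\sum_i (d k i)%:~R *: v i| `^ q).
  by rewrite sumr_const card_ffun card_bool card_ord -[RHS]mulr_natl natrX.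
under eq_bigr => h _ do rewrite (shift h).
rewrite exchange_big/=.
transitivity (\sum_(k : torus) 2 ^+ n * sign_average q v); last first.
  by rewrite sumr_const -[LHS]mulr_natl mulrCA.
apply: eq_bigr => k _; rewrite /sign_average mulVKf//.
have [eta etaE] : exists eta : signs n, forall i, d k i = (-1) ^+ eta i.
  have /choice[b hb] : forall i, exists b : bool, d k i = (-1) ^+ b.
    by move=> i; exact: zigzag_signed_step.
  by exists [ffun i => b i] => i; rewrite ffunE.
rewrite [RHS](reindex_inj (@flip_inj n eta)); apply: eq_bigr => h _.
congr (`|_| `^ q); apply: eq_bigr => i _; rewrite etaE ffunE -signr_addb addbC.
by rewrite rmorphXn/= rmorphN1.
Qed.

(** The all-plus step taken 2 l times is a half turn in every coordinate and negates the map, so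
    twice the map telescopes into 2 l increments of known norm. *)
Lemma lq_zigzag_map :
  2 * lq q zigzag_map <= (2 * l)%:R * (#|{: torus}|%:R * sign_average q v) `^ q^-1.
Proof.
pose s := signed_step torus_basis ([ffun=> false] : signs n).
have inj k : injective (fun x : torus => x + s *+ k) by exact: addIr.
have sl i : (s *+ (2 * l)) 0 i = inZp (2 * l).
  by rewrite mulrn_row signed_step_coord ffunE inZp_mulrn.
have anti k : zigzag_map (k + s *+ (2 * l)) = - zigzag_map k.
  rewrite -sumrN; apply: eq_bigr => i _.
  by rewrite /wave mxE sl zigzag_Zp_add zigzag_half// intrN scaleNr.
have tele m k : zigzag_map (k + s *+ m) - zigzag_map k =
    \sum_(i < m) (zigzag_map (k + s *+ i + s) - zigzag_map (k + s *+ i)).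
  elim: m => [|m IH]; first by rewrite mulr0n addr0 subrr big_ord0.
  rewrite big_ord_recr/= -IH mulrSr addrA.
  by rewrite [RHS]addrC [RHS]addrA subrK.
have -> : 2 * lq q zigzag_map = lq q (fun k => \sum_(i < 2 * l)
    (zigzag_map (k + s *+ i + s) - zigzag_map (k + s *+ i))).
  have E : (fun k => \sum_(i < 2 * l)
    (zigzag_map (k + s *+ i + s) - zigzag_map (k + s *+ i))) =
    (fun k => - 2 *: zigzag_map k).
    by apply/funext => k; rewrite -tele anti scaleNr scaler_nat mulr2n opprD.
  by rewrite E (lqZ q1 (- 2) zigzag_map) normrN normr_nat.
apply: le_trans (lq_sum q1 _ _) _.
have <- : \sum_(i < 2 * l) (#|{: torus}|%:R * sign_average q v) `^ q^-1 =
    (2 * l)%:R * (#|{: torus}|%:R * sign_average q v) `^ q^-1.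
  by rewrite sumr_const card_ord -[LHS]mulr_natl.
apply: ler_sum => i _.
rewrite (lq_reindex q (fun k => zigzag_map (k + s) - zigzag_map k) (inj i)).
apply: lq_le (powR_ge0 _ _) _ => //; rewrite /s sum_zigzag_map_step.
rewrite -powRrM mulVf ?gt_eqF// powRr1// -(sum_zigzag_map_step [ffun=> false]).
exact: sumr_ge0.
Qed.

End ZigzagEmbedding.

(** * Weak cotype of the domain *)

Lemma powR_add1_le (R : realType) (q t : R) : 0 <= q -> 0 <= t ->
  (t + 1) `^ q <= 2 `^ q * (t `^ q + 1).
Proof.
move=> q0 t0; have [t1|t1] := leP t 1.
  apply: (le_trans (y := 2 `^ q * 1)); last by rewrite ler_wpM2l ?powR_ge0// lerDr powR_ge0.
  rewrite mulr1 ge0_ler_powR ?nnegrE ?addr_ge0//.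
  by rewrite -[leRHS]/(1 + 1) lerD2r.
apply: (le_trans (y := 2 `^ q * t `^ q)); last by rewrite ler_wpM2l ?powR_ge0// lerDl.
rewrite -powRM// ge0_ler_powR ?nnegrE ?addr_ge0 ?mulr_ge0//.
by rewrite mulr_natl mulr2n lerD2l ltW.
Qed.

Lemma edge_energy_coarse_le (R : realType) (X Y : normedModType R) (q A : R)
    (f : X -> Y) (l M n : nat) (v : 'I_n -> X) :
  1 <= q -> 0 < A -> M.+1 = (4 * l)%N ->
  (forall x z, `|f x - f z| <= A * (`|x - z| + 1)) -> sign_average q v <= 2 ->
  edge_energy q (@torus_basis M n) (fun k => f (zigzag_map l v k)) `^ q^-1 <=
  6 * A * #|{: 'rV['I_M.+1]_n}|%:R `^ q^-1.
Proof.
move=> q1 A0 ME hA hS; have q0 : 0 < q := lt_le_trans ltr01 q1.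
pose step (e : signs n) := signed_step (@torus_basis M n) e.
set N : R := #|_|%:R; have N0 : 0 <= N by exact: ler0n.
have n2 : 0 < 2 ^+ n :> R by rewrite exprn_gt0.
have per_e (e : signs n) : \sum_(k : 'rV['I_M.+1]_n)
    `|f (zigzag_map l v (k + step e)) - f (zigzag_map l v k)| `^ q <= (6 * A) `^ q * N.
  apply: (le_trans (y := \sum_(k : 'rV['I_M.+1]_n) (2 * A) `^ q *
     (`|zigzag_map l v (k + step e) - zigzag_map l v k| `^ q + 1))).
    apply: ler_sum => k _; rewrite [2 * A]mulrC powRM ?(ltW A0)// -mulrA.
    apply: (le_trans (y := A `^ q *
        (`|zigzag_map l v (k + step e) - zigzag_map l v k| + 1) `^ q)).
      rewrite -powRM ?(ltW A0) ?addr_ge0// ge0_ler_powR ?nnegrE ?(ltW q0)//.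
      by rewrite mulr_ge0 ?(ltW A0) ?addr_ge0.
    by rewrite ler_wpM2l ?powR_ge0// powR_add1_le// ltW.
  rewrite -mulr_sumr big_split/= (sum_zigzag_map_step q1 v ME e) sumr_const -/N.
  (* The 2 comes from [powR_add1_le]; 3 is the bound 2 on the sign average plus the additive 1, and
     3 <= 3^q. *)
  have -> : 6 * A = 3 * (2 * A) by ring.
  rewrite [in leRHS]powRM ?mulr_ge0 ?(ltW A0)// [in leRHS]mulrAC mulrC.
  rewrite ler_wpM2r ?powR_ge0//.
  apply: (le_trans (y := N * 2 + N)); first by rewrite lerD2r ler_wpM2l.
  have -> : N * 2 + N = 3 * N by ring.
  by rewrite ler_wpM2r// le1r_powR// ler1n.
have hE : edge_energy q (@torus_basis M n) (fun k => f (zigzag_map l v k)) <= (6 * A) `^ q * N.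
  rewrite /edge_energy ler_pdivrMl//.
  apply: le_trans (ler_sum _ (fun e _ => per_e e)) _.
  by rewrite sumr_const card_ffun card_bool card_ord -[leLHS]mulr_natl natrX.
have E0 : 0 <= edge_energy q (@torus_basis M n) (fun k => f (zigzag_map l v k)).
  by rewrite mulr_ge0 ?invr_ge0 ?(ltW n2)// sumr_ge0// => e _; exact: sumr_ge0.
apply: (le_trans (y := ((6 * A) `^ q * N) `^ q^-1)).
  rewrite ge0_ler_powR ?nnegrE ?invr_ge0 ?(ltW q0)//.
  by rewrite mulr_ge0 ?powR_ge0.
rewrite powRM ?powR_ge0// -powRrM divff ?gt_eqF// powRr1//.
by rewrite mulr_ge0 ?(ltW A0).
Qed.

Lemma powR_lt1 (R : realType) (q t : R) : 0 <= q -> 0 <= t -> t `^ q < 1 -> t < 1.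
Proof.
move=> q0 t0; rewrite !ltNge; apply: contra => t1.
have one : 1 `^ q = 1 :> R by rewrite powR1.
by rewrite -one ge0_ler_powR ?nnegrE.
Qed.

Lemma powR_ge1 (R : realType) (x q : R) : 1 <= x -> 0 <= q -> 1 <= x `^ q.
Proof.
by move=> x1 q0; rewrite -[leLHS](powRr0 x) ler_powR.
Qed.

Lemma powR4_ge16 (R : realType) (q : R) : 2 <= q -> 16 <= 4 `^ q.
Proof.
move=> q2; apply: (le_trans (y := 4 `^ 2%:R)); last by rewrite ler_powR// ler1n.
by rewrite powR_mulrn// expr2 -natrM.
Qed.

Section LargeCoordinates.
Context (R : realType) (X Y : normedModType R) (q K A alpha : R) (f : X -> Y).
Hypotheses (q2 : 2 <= q) (K0 : 0 < K) (A0 : 0 < A).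
Hypothesis hK : forall n (g : signs n -> Y),
  \sum_(j < n) `|rademacher_coef g j| `^ q <= K * ((2 ^+ n)^-1 * \sum_w `|g w| `^ q).
Hypothesis hA : forall x z, `|f x - f z| <= A * (`|x - z| + 1).
Hypotheses (alpha0 : 0 <= alpha) (alpha1 : alpha < 1).

Let q1 : 1 <= q.
Proof. by apply: le_trans q2; rewrite ler1n. Qed.

Let q0 : 0 < q := lt_le_trans ltr01 q1.

(** For l <= 2 |J|^(1/q) the factor in [metric_cotype] is at most 4 + 4 K^(1/q); the edge norm
    contributes 6 A. *)
Let Lam : R := (4 + 4 * K `^ q^-1) * (6 * A).

Let Lam0 : 0 < Lam.
Proof. by rewrite mulr_gt0 ?mulr_gt0// ltr_pwDl// mulr_ge0 ?powR_ge0. Qed.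

(* Averaging over the torus: some coordinate j in J and some pair of antipodal
   points in direction j satisfy all the typical bounds at once. *)
Lemma exists_good_pair n (v : 'I_n -> X) (J : {set 'I_n}) (l : nat) :
  sign_average q v <= 2 -> (0 < #|J|)%N -> (0 < l)%N ->
  l%:R <= 2 * #|J|%:R `^ q^-1 ->
  exists j x z, [/\ j \in J, `|x| < 4 * l%:R, `|z| < 4 * l%:R,
    l%:R * `|v j| <= `|x - z| & `|f x - f z| < 4 * Lam].
Proof.
move=> hS J0 l0 hl; pose M := (4 * l).-1.
have ME : M.+1 = (4 * l)%N by rewrite prednK// muln_gt0.
pose G := 'rV['I_M.+1]_n; pose Phi := zigzag_map l v : G -> X.
pose a := @torus_basis M n.
set N : R := #|{: G}|%:R.
have N0 : 0 < N by rewrite ltr0n; apply/card_gt0P; exists 0.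
have lr : 0 < l%:R :> R by rewrite ltr0n.
have Jr : 0 < #|J|%:R :> R by rewrite ltr0n.
have [j jJ hj] := metric_cotype q1 K0 hK a (fun k => f (Phi k)) l J0.
have hD : lq q (fun k : G => f (Phi (k + a j *+ (2 * l))) - f (Phi k)) <= Lam * N `^ q^-1.
  apply: le_trans hj _.
  have hE := edge_energy_coarse_le q1 A0 ME hA hS.
  rewrite /Lam -[leRHS]mulrA.
  have P0 : 0 <= 4 + 2 * l%:R * (K / #|J|%:R) `^ q^-1.
    by rewrite addr_ge0// !mulr_ge0// powR_ge0.
  apply: ler_pM P0 (powR_ge0 _ _) _ hE.
  rewrite lerD2l powRM ?invr_ge0 ?(ltW K0)// powRV//.
  have Jq : 0 < #|J|%:R `^ q^-1 :> R by exact: powR_gt0.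
  rewrite mulrCA [leRHS]mulrC ler_wpM2l ?powR_ge0// mulrC.
  rewrite ler_pdivrMl//.
  have -> : #|J|%:R `^ q^-1 * 4 = 2 * (2 * #|J|%:R `^ q^-1) :> R by ring.
  by rewrite ler_wpM2l.
have hPhi : lq q Phi <= l%:R * (N * 2) `^ q^-1.
  rewrite -(ler_pM2l (ltr0Sn R 1)); apply: le_trans (lq_zigzag_map q1 v ME) _.
  rewrite natrM -mulrA ler_wpM2l// ler_wpM2l// ge0_ler_powR ?nnegrE ?invr_ge0 ?(ltW q0)//.
  - by rewrite -(sum_zigzag_map_step q1 v ME [ffun=> false]) sumr_ge0.
  - by rewrite mulr_ge0 ?(ltW N0).
  - by rewrite ler_wpM2l ?(ltW N0).
have qq := powR4_ge16 q2.
(* Chebyshev at four times the typical size: q >= 2 gives 4^q >= 16. *)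
have sum_ratio (F : G -> R) (c d : R) : (forall k, 0 <= F k) -> 0 < c -> 0 <= d ->
    \sum_k F k `^ q <= c `^ q * d -> \sum_k (F k / (4 * c)) `^ q <= d / 16.
  move=> F0 c0 d0 h; under eq_bigr do rewrite powRM ?invr_ge0 ?mulr_ge0 ?(ltW c0)//.
  rewrite -mulr_suml powRV ?mulr_ge0 ?(ltW c0)// powRM ?(ltW c0)//.
  rewrite ler_pdivrMr ?mulr_gt0 ?powR_gt0//.
  apply: le_trans h _.
  have -> : d / 16 * (4 `^ q * c `^ q) = c `^ q * d * (4 `^ q / 16).
    by move: (4 `^ q) (c `^ q) => y z; field.
  by rewrite ler_peMr ?mulr_ge0 ?powR_ge0// ler_pdivlMr// mul1r.
have s1 : \sum_k (`|Phi k| / (4 * l%:R)) `^ q <= N * 2 / 16.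
  apply: sum_ratio => //; first by rewrite mulr_ge0 ?(ltW N0).
  apply: le_trans (le_lqX q1 hPhi) _; rewrite powRM ?powR_ge0// -powRrM mulVf ?gt_eqF//.
  by rewrite powRr1// mulr_ge0 ?(ltW N0).
have s2 : \sum_(k : G) (`|Phi (k + a j *+ (2 * l))| / (4 * l%:R)) `^ q <= N * 2 / 16.
  by move: s1; rewrite (reindex_inj (addIr (a j *+ (2 * l)))).
have s3 : \sum_(k : G) (`|f (Phi (k + a j *+ (2 * l))) - f (Phi k)| / (4 * Lam)) `^ q <= N / 16.
  apply: (sum_ratio _ _ _ _ Lam0 (ltW N0)) => //.
  apply: le_trans (le_lqX q1 hD) _; rewrite powRM ?powR_ge0 ?(ltW Lam0)//.
  rewrite -powRrM mulVf ?gt_eqF//.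
  by rewrite powRr1// ltW.
pose b (k : G) := (`|Phi k| / (4 * l%:R)) `^ q +
  (`|Phi (k + a j *+ (2 * l))| / (4 * l%:R)) `^ q +
  (`|f (Phi (k + a j *+ (2 * l))) - f (Phi k)| / (4 * Lam)) `^ q.
have b0 k : 0 <= b k by rewrite !addr_ge0 ?powR_ge0.
have N5 : N * 2 / 16 + N * 2 / 16 + N / 16 = N * (5 / 16).
  by move: (N) => y; field.
have sb : \sum_k b k <= N * (5 / 16).
  by rewrite !big_split/= -N5; exact: lerD (lerD s1 s2) s3.
have sb' : \sum_(k : G) b (k + a j *+ l) <= N * (5 / 16).
  by move: sb; rewrite (reindex_inj (addIr (a j *+ l))).
(* Two translates are controlled together because [zigzag_quarter] guarantees a large wave at only
   one of them; 5/16 + 5/16 is still below 1. *)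
have [k0 _ hk0] : exists2 k, xpredT k & b k + b (k + a j *+ l) <= 5 / 8.
  have N10 : N * (5 / 16) + N * (5 / 16) = \sum_(k : G) 5 / 8.
    by rewrite sumr_const -[RHS]mulr_natl -/N; move: (N) => y; field.
  apply: (@sum_le_exists R G xpredT 0 (fun k => b k + b (k + a j *+ l)) (fun=> 5 / 8)) => //.
  by rewrite big_split/= -N10; exact: lerD sb sb'.
have [k [bk wk]] : exists k : G, b k < 1 /\ l%:R <= 2 * `|(wave l k j)%:~R| :> R.
  have quarter : `|(wave l k0 j)%:~R| + `|(wave l (k0 + a j *+ l) j)%:~R| = l%:R :> R.
    rewrite /wave mxE torus_basis_mulrn eqxx zigzag_Zp_add//.
    by rewrite -!intr_norm -intrD zigzag_quarter.
  have b58 : 5 / 8 < 1 :> R by rewrite ltr_pdivrMr// mul1r ltr_nat.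
  have [h|h] := leP (l%:R : R) (2 * `|(wave l k0 j)%:~R|).
    exists k0; split=> //; apply: le_lt_trans b58.
    by apply: le_trans hk0; rewrite lerDl.
  exists (k0 + a j *+ l); split.
    by apply: le_lt_trans b58; apply: le_trans hk0; rewrite lerDr.
  have -> : 2 * `|(wave l (k0 + a j *+ l) j)%:~R| =
      2 * l%:R - 2 * `|(wave l k0 j)%:~R| :> R by rewrite -quarter; ring.
  by rewrite lerBrDr [leRHS]mulr_natl mulr2n lerD2l ltW.
exists j, (Phi k), (Phi (k + a j *+ (2 * l))).
have p0 (t : R) : 0 <= t `^ q by exact: powR_ge0.
have l4 : 0 < 4 * l%:R :> R by rewrite mulr_gt0.
have L4 : 0 < 4 * Lam by rewrite mulr_gt0.
split=> //.
- rewrite -[ltRHS]mul1r -ltr_pdivrMr//; apply: (powR_lt1 (ltW q0)).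
    by rewrite divr_ge0// ltW.
  by apply: le_lt_trans bk; rewrite /b -addrA lerDl addr_ge0.
- rewrite -[ltRHS]mul1r -ltr_pdivrMr//; apply: (powR_lt1 (ltW q0)).
    by rewrite divr_ge0// ltW.
  by apply: le_lt_trans bk; rewrite /b addrAC lerDr addr_ge0.
- have wj : wave l (k + a j *+ (2 * l)) j = - wave l k j.
    by rewrite /wave mxE torus_basis_mulrn eqxx zigzag_Zp_add// zigzag_half.
  have wi i : i != j -> wave l (k + a j *+ (2 * l)) i = wave l k i.
    by move=> /negbTE ij; rewrite /wave mxE torus_basis_mulrn ij addr0.
  rewrite /Phi /zigzag_map -sumrB (bigD1 j)//= big1 ?addr0; last first.
    by move=> i ij; rewrite wi// subrr.
  rewrite wj intrN scaleNr opprK -scalerDl normrZ ler_wpM2r//.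
  by rewrite -mulr2n normrMn -[leRHS]mulr_natl.
- rewrite distrC -[ltRHS]mul1r -ltr_pdivrMr//; apply: (powR_lt1 (ltW q0)).
    by rewrite divr_ge0// ltW.
  by apply: le_lt_trans bk; rewrite /b lerDr addr_ge0.
Qed.

(** If the bound failed, the good pair would satisfy |x - z| >= l d >= l^alpha (t0 + 5), enough to
    trigger expansion and to make rho exceed the bound on the images. *)
Lemma large_coordinates_bound : expanding_at_rate alpha f ->
  exists2 B : R, 0 < B & forall n (v : 'I_n -> X) (J : {set 'I_n}) d,
    0 < d -> sign_average q v <= 2 -> (forall i, i \in J -> d <= `|v i|) ->
    d * #|J|%:R `^ ((1 - alpha) / q) <= B.
Proof.
move=> /(_ 1 ltr01)[rho [_ rho_oo hrho]].
have [t0 t00 ht0] : exists2 t0, 0 <= t0 & forall t, t0 <= t -> 4 * Lam <= rho t.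
  move/cvgryPge: rho_oo => /(_ (4 * Lam)) [m [_ hm]].
  exists (Num.max 0 (m + 1)); first by rewrite le_max lexx.
  move=> t; rewrite ge_max => /andP[_ mt]; apply: hm.
  by apply: lt_le_trans mt; rewrite ltrDl.
(* At L = 1 the expansion threshold is at most 4 l^alpha + 1 <= 5 l^alpha, since the norms are below
   4 l; beyond t0, rho is at least 4 [Lam]. *)
exists (t0 + 5); first by rewrite ltr_wpDl.
move=> n v J d d0 hS hd; have [J0|J0] := posnP #|J|.
  rewrite J0 powR0 ?mulr0 ?addr_ge0// mulf_neq0 ?invr_eq0 ?gt_eqF// subr_gt0//.
have Jr : 1 <= #|J|%:R :> R by rewrite ler1n.
pose nu : R := #|J|%:R `^ q^-1.
have nu1 : 1 <= nu by rewrite powR_ge1// invr_ge0 ltW.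
have nu0 : 0 <= nu := powR_ge0 _ _.
pose l := (Num.truncn nu).+1.
have nul : nu <= l%:R by rewrite ltW// truncnS_gt.
have l2 : l%:R <= 2 * nu.
  rewrite /l -[_.+1%:R]natr1 [leRHS]mulr_natl mulr2n lerD//.
  by have /andP[] := truncn_itv nu0.
have [j [x [z [jJ xl zl hxz hf]]]] := exists_good_pair hS J0 (ltn0Sn _ : (0 < l)%N) l2.
have l1 : 1 <= l%:R :> R by rewrite ler1n.
have la1 : 1 <= l%:R `^ alpha :> R by exact: powR_ge1.
rewrite leNgt; apply/negP => hB; move: hf; rewrite ltNge => /negP; apply.
have nuE : #|J|%:R `^ ((1 - alpha) / q) = nu `^ (1 - alpha).
  by rewrite -powRrM mulrC.
rewrite nuE in hB.
have ld : l%:R `^ alpha * (t0 + 5) <= `|x - z|.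
  apply: le_trans hxz; apply: (le_trans (y := l%:R * d)); last first.
    by rewrite ler_wpM2l// hd.
  have -> : l%:R * d = l%:R `^ alpha * (d * l%:R `^ (1 - alpha)).
    rewrite [RHS]mulrCA -powRD; first by rewrite subrKC powRr1// mulrC.
    by rewrite pnatr_eq0 implybT.
  rewrite ler_wpM2l ?powR_ge0//; apply: le_trans (ltW hB) _.
  rewrite ler_wpM2l ?(ltW d0)// ge0_ler_powR ?nnegrE//.
  by rewrite subr_ge0 ltW.
apply: (le_trans (y := rho `|x - z|)).
  apply: ht0; apply: le_trans ld.
  by apply: le_trans (ler_peMl (addr_ge0 t00 _) la1); rewrite ?lerDl.
apply: hrho; rewrite mul1r; apply: le_trans ld.
have small (y : X) : `|y| < 4 * l%:R -> `|y| `^ alpha <= 4 * l%:R `^ alpha.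
  move=> hy; apply: (le_trans (y := (4 * l%:R) `^ alpha)).
    by rewrite ge0_ler_powR ?nnegrE ?(ltW hy)// mulr_ge0.
  rewrite powRM// ler_wpM2r ?powR_ge0//.
  rewrite -[leRHS]powRr1// ler_powR ?ler1n// ltW//.
apply: (le_trans (y := 4 * l%:R `^ alpha + l%:R `^ alpha)).
  by rewrite lerD// ge_max !small.
have -> : 4 * l%:R `^ alpha + l%:R `^ alpha = l%:R `^ alpha * 5 by ring.
by rewrite ler_wpM2l ?powR_ge0// lerDr.
Qed.

End LargeCoordinates.

(** * Cotype from weak cotype *)

Lemma sign_averageZ (R : realType) (X : normedModType R) (r c : R) n (x : 'I_n -> X) :
  0 <= c -> sign_average r (fun i => c *: x i) = c `^ r * sign_average r x.
Proof.
move=> c0; rewrite /sign_average [RHS]mulrCA [in RHS]mulr_sumr; congr (_ * _).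
apply: eq_bigr => e _; rewrite -powRM//; congr (_ `^ r).
rewrite -[c in RHS]ger0_norm// -normrZ scaler_sumr; congr (`|_|).
by apply: eq_bigr => i _; rewrite !scalerA mulrC.
Qed.

Lemma sign_average_le_add1 (R : realType) (X : normedModType R) (q r : R) n
    (x : 'I_n -> X) : 0 <= q -> q <= r -> sign_average q x <= 1 + sign_average r x.
Proof.
move=> q0 qr; have n2 : 0 < 2 ^+ n :> R by rewrite exprn_gt0.
have avg1 : (2 ^+ n)^-1 * \sum_(e : {ffun 'I_n -> bool}) (1 : R) = 1.
  by rewrite sumr_const card_ffun card_bool card_ord natrX mulVf ?gt_eqF.
rewrite /sign_average -[X in X + _]avg1 -mulrDr -big_split/= ler_wpM2l ?invr_ge0 ?(ltW n2)//.
apply: ler_sum => e _; move: `|_| (normr_ge0 (\sum_(i < n) (-1) ^+ e i *: x i)) => t t0.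
have [t1|t1] := leP t 1.
  apply: (le_trans (y := 1)); last by rewrite lerDl powR_ge0.
  have one : 1 `^ q = 1 :> R by rewrite powR1.
  by rewrite -[leRHS]one ge0_ler_powR ?nnegrE.
by apply: (le_trans (y := t `^ r)); rewrite ?lerDr// ler_powR// ltW.
Qed.

Lemma powR_dyadic_le (R : realType) (B r t : R) m : 0 <= B -> 0 <= r ->
  0 <= t -> t <= B ->
  t `^ r <= \sum_(k < m) (B / 2 ^+ k.+1 < t)%R%:R * (B / 2 ^+ k) `^ r + (B / 2 ^+ m) `^ r.
Proof.
move=> B0 r0 t0 tB; elim: m => [|m IH].
  by rewrite big_ord0 add0r expr0 divr1 ge0_ler_powR ?nnegrE.
rewrite big_ord_recr/=; have [h|h] := ltP (B / 2 ^+ m.+1) t.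
  by rewrite mul1r; apply: le_trans IH _; rewrite lerDl powR_ge0.
rewrite mul0r addr0.
apply: (le_trans (y := (B / 2 ^+ m.+1) `^ r)).
  by rewrite ge0_ler_powR ?nnegrE ?divr_ge0 ?exprn_ge0.
by rewrite lerDr sumr_ge0// => k _; rewrite mulr_ge0 ?powR_ge0.
Qed.

Lemma geometric_sum_le (R : realType) (x : R) m : 0 <= x -> x < 1 ->
  \sum_(k < m) x ^+ k <= (1 - x)^-1.
Proof.
move=> x0 x1; have px : 0 < 1 - x by rewrite subr_gt0.
rewrite -[leRHS]mul1r ler_pdivlMr// mulrC.
by rewrite sub1_geometric gerBl exprn_ge0.
Qed.

Section CotypeOfLargeCoordinates.
Context (R : realType) (X : normedModType R) (q theta B r : R).
Hypotheses (q0 : 0 <= q) (theta0 : 0 < theta) (B0 : 0 < B).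
Hypothesis large : forall n (v : 'I_n -> X) (J : {set 'I_n}) d,
  0 < d -> sign_average q v <= 2 -> (forall i, i \in J -> d <= `|v i|) ->
  d * #|J|%:R `^ theta <= B.
Hypotheses (qr : q <= r) (r1 : 1 <= r) (thetar : theta^-1 < r).

Let r0 : 0 <= r. Proof. exact: le_trans r1. Qed.

(** At level k, norms of order B 2^-k, [large] allows at most P^(k + 1) vectors, each contributing
    at most B^r Q^k; the ratio P Q is below 1 because r > 1 / theta. *)
Let P : R := 2 `^ theta^-1.
Let Q : R := 2 `^ (- r).

Let P0 : 0 <= P. Proof. exact: powR_ge0. Qed.
Let Q0 : 0 <= Q. Proof. exact: powR_ge0. Qed.

Let PQ1 : P * Q < 1.
Proof.
rewrite /P /Q -powRD; last by rewrite pnatr_eq0 implybT.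
rewrite -opprB powRN invf_lt1 ?powR_gt0//.
have d0 : 0 < r - theta^-1 by rewrite subr_gt0.
have one : 1 `^ (r - theta^-1) = 1 :> R by rewrite powR1.
by rewrite -[ltLHS]one gt0_ltr_powR ?nnegrE ?ltr1n.
Qed.

Let Q2 : Q <= 2^-1.
Proof.
rewrite /Q powRN lef_pV2 ?posrE ?powR_gt0//.
by rewrite -[leLHS]powRr1// ler_powR// ler1n.
Qed.

Let dyadicE k : (B / 2 ^+ k) `^ r = B `^ r * Q ^+ k.
Proof.
rewrite powRM ?(ltW B0) ?invr_ge0 ?exprn_ge0//; congr (_ * _).
rewrite powRV ?exprn_ge0// /Q powRN exprVn; congr (_^-1).
by rewrite -[2 ^+ k]powR_mulrn// -powRrM mulrC powRrM powR_mulrn// powR_ge0.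
Qed.

Lemma normalized_cotype_sum_le n (v : 'I_n -> X) : sign_average r v <= 1 ->
  \sum_i `|v i| `^ r <= B `^ r * (P * (1 - P * Q)^-1 + 1).
Proof.
move=> hv.
have hq : sign_average q v <= 2.
  by apply: le_trans (sign_average_le_add1 v q0 qr) _; rewrite -[leRHS]/(1 + 1) lerD2l.
(* [large] on a singleton J. *)
have vB i : `|v i| <= B.
  have [->//|vi] := eqVneq `|v i| 0; first exact: ltW.
  have vi0 : 0 < `|v i| by rewrite lt_def vi normr_ge0.
  have := large (J := finset.set1 i) vi0 hq; rewrite cards1 powR1 mulr1; apply.
  by move=> j /finset.set1P ->.
pose J k : {set 'I_n} := finset.finset (fun i => B / 2 ^+ k.+1 < `|v i|).
have cJ k : #|J k|%:R <= P ^+ k.+1.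
  have k2 : 0 < 2 ^+ k.+1 :> R by rewrite exprn_gt0.
  have d0 : 0 < B / 2 ^+ k.+1 by rewrite divr_gt0.
  have /(large d0 hq) : forall i, i \in J k -> B / 2 ^+ k.+1 <= `|v i|.
    by move=> i; rewrite inE => /ltW.
  rewrite -mulrA ger_pMr// ler_pdivrMl// mulr1 => h.
  rewrite /P -powR_mulrn ?powR_ge0// -powRrM mulrC powRrM powR_mulrn//.
  have -> : #|J k|%:R = (#|J k|%:R `^ theta) `^ theta^-1 :> R.
    by rewrite -powRrM divff ?gt_eqF// powRr1.
  by rewrite ge0_ler_powR ?nnegrE ?powR_ge0 ?invr_ge0 ?(ltW theta0) ?(ltW k2).
apply: (le_trans (y := \sum_i (\sum_(k < n) (B / 2 ^+ k.+1 < `|v i|)%R%:R * (B / 2 ^+ k) `^ r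
    + (B / 2 ^+ n) `^ r))).
  by apply: ler_sum => i _; apply: powR_dyadic_le => //; exact: ltW.
(* Truncating at depth n, the number of vectors, leaves n remainders of size B^r Q^n, and n Q^n <= n
   2^-n <= 1. *)
rewrite big_split/= mulrDr mulr1; apply: lerD; last first.
  rewrite sumr_const card_ord -[leLHS]mulr_natr dyadicE -mulrA ger_pMr ?powR_gt0//.
  apply: (le_trans (y := 2^-1 ^+ n * n%:R)).
    by rewrite ler_wpM2r// lerXn2r ?nnegrE ?invr_ge0.
  by rewrite exprVn ler_pdivrMl ?exprn_gt0// mulr1 -natrX ler_nat ltnW// ltn_expl.
rewrite exchange_big/=.
apply: (le_trans (y := \sum_(k < n) B `^ r * (P * (P * Q) ^+ k))).
  apply: ler_sum => k _; rewrite -mulr_suml dyadicE mulrCA ler_wpM2l ?powR_ge0//.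
  have -> : \sum_i (B / 2 ^+ k.+1 < `|v i|)%R%:R = #|J k|%:R :> R.
    rewrite -natr_sum -sum1_card [in RHS]big_mkcond/=; congr (_%:R).
    by apply: eq_bigr => i _; rewrite inE; case: (_ < _).
  by rewrite exprMn mulrA -exprS ler_wpM2r// exprn_ge0.
rewrite -mulr_sumr -mulr_sumr ler_wpM2l ?powR_ge0// ler_wpM2l//.
by rewrite geometric_sum_le// mulr_ge0.
Qed.

Lemma cotype_of_large_coordinates : has_cotype X r.
Proof.
pose D := B `^ r * (P * (1 - P * Q)^-1 + 1).
have D0 : 0 < D.
  by rewrite mulr_gt0 ?powR_gt0// ltr_wpDl// mulr_ge0// invr_ge0 subr_ge0 ltW.
have rp : 0 < r := lt_le_trans ltr01 r1.
exists D^-1; first by rewrite invr_gt0.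
move=> n x; apply/ler_addgt0Pr => e e0.
have S0 : 0 <= sign_average r x.
  by rewrite mulr_ge0 ?invr_ge0 ?exprn_ge0// sumr_ge0// => w _; exact: powR_ge0.
(* The slack e keeps the normalising factor finite when the sign average is 0. *)
set s := _ + e; have s0 : 0 < s by rewrite ltr_wpDl.
pose c := s `^ (- r^-1).
have cr : c `^ r = s^-1.
  by rewrite -powRrM mulNr mulVf ?gt_eqF// powRN powRr1// ltW.
have c0 : 0 <= c by exact: powR_ge0.
have := @normalized_cotype_sum_le n (fun i => c *: x i).
rewrite sign_averageZ// cr ler_pdivrMl// mulr1 lerDl => /(_ (ltW e0)).
have -> : \sum_i `|c *: x i| `^ r = s^-1 * \sum_i `|x i| `^ r.
  rewrite mulr_sumr; apply: eq_bigr => i _.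
  by rewrite normrZ ger0_norm// powRM// cr.
by rewrite -/D ler_pdivrMl// ler_pdivrMl// mulrC.
Qed.

End CotypeOfLargeCoordinates.

Theorem theorem1p3 (R : realType) (X Y : completeNormedModType R)
    (hY : nontrivial_type Y) (alpha : R) (halpha0 : 0 <= alpha)
    (halpha1 : alpha <= 1)
    (hf : exists f : X -> Y, coarse f /\ expanding_at_rate alpha f) :
  (cotype_index X <=
     if (alpha == 1)%R then +oo else cotype_index Y * ((1 - alpha)^-1)%:E)%E.
Proof.
case: eqVneq => [_|alpha_neq1]; first exact: leey.
have alpha1 : alpha < 1 by rewrite lt_neqAle alpha_neq1.
have beta0 : 0 < 1 - alpha by rewrite subr_gt0.
have [f [coarse_f expanding_f]] := hf.
have [A A0 hA] := coarse_lipschitz coarse_f.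
(* With 1 - alpha moved to the left, it suffices to treat each cotype q of Y; having none leaves
   nothing to prove. *)
rewrite lee_pdivlMr//.
apply: le_ereal_inf_tmp => _ [q [q2 cotype_q] <-].
have q0 : 0 <= q by apply: le_trans q2.
rewrite -lee_pdivlMr// -EFinM; apply/lee_addgt0Pr => e e0.
have [K K0 hK] := rademacher_cotype q2 hY cotype_q.
have [B B0 hB] := large_coordinates_bound q2 K0 A0 hK hA halpha0 alpha1 expanding_f.
have q_le : q <= q / (1 - alpha).
  by rewrite ler_peMr// invf_ge1// gerBl.
have lt_r : q / (1 - alpha) < q / (1 - alpha) + e by rewrite ltrDl.
have r_ge : q <= q / (1 - alpha) + e by exact: le_trans q_le (ltW lt_r).
apply: ereal_inf_lbound; exists (q / (1 - alpha) + e); last by rewrite EFinD.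
split; first exact: le_trans r_ge.
apply: (cotype_of_large_coordinates q0 _ B0 hB r_ge).
- by rewrite divr_gt0// (lt_le_trans _ q2).
- by apply: le_trans r_ge; apply: le_trans q2; rewrite ler1n.
- by rewrite invf_div.
Qed.
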